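(* Let $q\ge4$ be an even prime power (a power of $2$), $n\ge3$ an odd integer, and $m\ge2$ an integer such that $m$ divides $q^n+1$ and $q+1$ divides $m$. For each integer $k$ with $$q-1\le k\le\frac{(q^n-q^2+q)(q^n+1)}{m}+q^{n+1}-q^n,$$ there exists a linear code over $\mathbb{F}_{q^{2n}}$ with parameters $$\left[N,\ km+1-\frac{(q-1)m-q^2+q+1}{2},\ N-km\right],$$ where $N=q^{2n}-q^{n+2}+(m+1)q^{n+1}-(m-1)q^n$.
   Context: A linear code with parameters $[N,k',d]$ over a finite field $\mathbb{F}$ is a linear subspace of $\mathbb{F}^N$ of dimension $k'$ whose minimum Hamming distance is exactly $d$. *)

(* Defs.v *)
From HB Require Import structures.
From mathcomp Require Import all_boot all_order all_algebra.

Set Implicit Arguments.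
Unset Strict Implicit.
Unset Printing Implicit Defensive.

Import GRing.Theory.
Local Open Scope ring_scope.

Definition hamming_dist (F : finFieldType) (N : nat) (u v : 'rV[F]_N) : nat :=
  #|[set i : 'I_N | u 0 i != v 0 i]|.

(* The minimum distance is attained by some pair of distinct codewords, so the
   zero code satisfies this for no d. *)
Definition has_min_distance (F : finFieldType) (N : nat)
    (C : {vspace 'rV[F]_N}) (d : nat) : Prop :=
  (exists u v : 'rV[F]_N,
      [/\ u \in C, v \in C, u != v & hamming_dist u v = d]) /\
  (forall u v : 'rV[F]_N,
      u \in C -> v \in C -> u != v -> (d <= hamming_dist u v)%N).

Definition is_linear_code (F : finFieldType) (N k d : nat)
    (C : {vspace 'rV[F]_N}) : Prop :=
  \dim C = k /\ has_min_distance C d.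

(* Main.v *)
(* With Q = q^n and r = m / (q+1), the code is a one-point evaluation code on the maximal curve
     y^(q+1) = t^2 + t,   z^r = y (t^(q-1) + 1) / (t + 1),
   a model of z^m = f(t), f = (t^2 + t) ((t^(q-1) + 1) / (t + 1))^(q+1).
   The monomials y^i z^l t^k with i <= q and l < r have pole orders 2ri + (q^2-q)l + mk at
   infinity, distinct for distinct monomials. A function with pole order w has at most w zeros,
   because its norm to F[t] has degree w. This gives the dimension and the lower bound on the
   distance; a product of k factors t - b, b running over values with m points above, attains it.

   It remains to count the t outside F_q with f(t) an m-th power, i.e. with f(t)^(Q-1) = c,
   c^((Q+1)/m) = 1. Over all c with c^((Q+1)/(q+1)) = 1 the count amounts to the number Q^2 + qQ
   of points of t^2 + t = y^(q+1), a quadratic character sum. For each such c <> 1 there are at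
   most Q - q^2 + q values: writing t = u^(q+1) and 1 + t = v^(q+1), the Drinfeld-type recursion
   u^(q^2) + u = w v^q, v^(q^2) + v = w u^q with w^(q+1) = f(t) expresses t + t^Q as a polynomial
   in f(t) and (t^2+t)^((Q+1)/(q+1)), and comparing this with its Q-th power gives an equation of
   degree Q for t, divisible by f. Subtracting these bounds leaves enough values for c^((Q+1)/m) = 1. *)

Require Import Defs.
From HB Require Import structures.
From mathcomp Require Import all_boot all_order all_algebra all_field perm.
From mathcomp Require Import zify ring.

Set Implicit Arguments.
Unset Strict Implicit.
Unset Printing Implicit Defensive.

Import Order.TTheory GRing.Theory Num.Theory.
Local Open Scope ring_scope.

Lemma subset_of_card (T : finType) (A : {set T}) (k : nat) :
  (k <= #|A|)%N -> exists2 B : {set T}, B \subset A & #|B| = k.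
Proof.
move=> kA; exists [set x in take k (enum A)].
  by apply/subsetP => x; rewrite inE => /mem_take; rewrite mem_enum.
rewrite cardsE (card_uniqP _) ?take_uniq ?enum_uniq // size_take -cardE.
by case: ltngtP kA.
Qed.

(** * Fibers of power maps on a finite field *)

Section FiniteFieldPowers.

Variable F : finFieldType.

Lemma expf_card_pred (x : F) : x != 0 -> x ^+ #|F|.-1 = 1.
Proof.
move=> x0; apply: (mulfI x0).
by rewrite -exprS prednK ?(ltnW (card_finNzRing_gt1 F)) // expf_card mulr1.
Qed.

Lemma card_root_lt (p : {poly F}) (A : {set F}) :
  p != 0 -> (forall x, x \in A -> root p x) -> (#|A| < size p)%N.
Proof.
move=> p0 hA; rewrite cardE; apply: max_poly_roots => //; last exact: enum_uniq.
by apply/allP => x; rewrite mem_enum => /hA.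
Qed.

Lemma card_pow_fiber_le (d : nat) (a : F) :
  (0 < d)%N -> (#|[set x : F | x ^+ d == a]| <= d)%N.
Proof.
move=> d0; rewrite -ltnS -(size_XnsubC a d0); apply: card_root_lt.
  by rewrite -size_poly_eq0 size_XnsubC.
by move=> x; rewrite inE rootE !hornerE => /eqP ->; rewrite subrr.
Qed.

(** The d k nonzero elements are spread over the fibers above the k-th roots of unity. There are at
    most k such roots and each fiber has at most d elements, so every bound is an equality. *)
Lemma card_pow_fiber (d k : nat) (a : F) :
  (d * k)%N = #|F|.-1 -> a ^+ k = 1 -> #|[set x : F | x ^+ d == a]| = d.
Proof.
move=> hdk ak; have hF := card_finNzRing_gt1 F.
have [d0 k0] : (0 < d)%N /\ (0 < k)%N.
  by apply/andP; rewrite -muln_gt0 hdk -subn1 subn_gt0.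
pose U := [set b : F | b ^+ k == 1].
have hU : (#|U| <= k)%N by apply: card_pow_fiber_le.
have aU : a \in U by rewrite inE ak.
have hsum : (\sum_(b in U) #|[set x : F | x ^+ d == b]| = d * k)%N.
  rewrite hdk -cardsT (cardsD1 0) inE /= add0n -sum1_card.
  rewrite [RHS](partition_big (fun x : F => x ^+ d) (mem U)) /=; last first.
    by move=> x; rewrite !inE andbT => x0; rewrite -exprM hdk expf_card_pred.
  apply: eq_bigr => b; rewrite inE => /eqP bk.
  rewrite -sum1_card; apply: eq_bigl => x; rewrite !inE andbT andbC.
  case: eqVneq => [xb|]; rewrite ?andbF ?andbT //=.
  apply/esym/negP => /eqP x0; move: bk; rewrite -xb x0 !expr0n.
  by rewrite (gtn_eqF d0) expr0n (gtn_eqF k0) => /esym/eqP; rewrite oner_eq0.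
apply/eqP; rewrite eqn_leq card_pow_fiber_le //= leqNgt; apply/negP => hlt.
move: hsum; rewrite (bigD1 a) //= => hsum.
have : (\sum_(b in U | b != a) #|[set x : F | x ^+ d == b]| <= #|U :\ a| * d)%N.
  rewrite -sum_nat_const (eq_bigl (fun b => b \in U :\ a)).
    by apply: leq_sum => b _; apply: card_pow_fiber_le.
  by move=> b; rewrite !inE andbC.
have := cardsD1 a U; rewrite aU => hc hS.
have : (d * #|U| <= d * k)%N by rewrite leq_mul2l hU orbT.
rewrite hc mulnDr muln1 -hsum [(d * #|_|)%N]mulnC.
by rewrite leqNgt -addSn leq_add.
Qed.

Lemma card_unity_root (d : nat) :
  (d %| #|F|.-1)%N -> #|[set x : F | x ^+ d == 1]| = d.
Proof.
by move=> /dvdnP[k hk]; apply: (@card_pow_fiber d k); rewrite ?expr1n // mulnC.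
Qed.

End FiniteFieldPowers.

(** * Continuants *)

Section PowersModSucc.

(** q is -1 modulo q + 1. This and the odd case make the quotients in [continuant] exact. *)
Lemma dvdn_even_pow (q j : nat) : (0 < q)%N -> (q.+1 %| q ^ j.*2 - 1)%N.
Proof.
move=> q0; rewrite -mul2n expnM subn1.
apply: dvdn_trans (dvdn_pred_predX _ _).
apply/dvdnP; exists (q - 1)%N; case: q q0 => // q _.
by rewrite expnS expn1; lia.
Qed.

Lemma dvdn_odd_pow (q j : nat) : (0 < q)%N -> (q.+1 %| q ^ j.*2.+1 + 1)%N.
Proof.
move=> q0.
have -> : (q ^ j.*2.+1 + 1 = q * (q ^ j.*2 - 1) + q.+1)%N.
  rewrite expnS mulnBr muln1 -[in RHS]addn1 addnA subnK // -{1}[q]muln1 leq_mul2l.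
  by rewrite expn_gt0 q0 orbT.
by rewrite dvdn_add ?dvdnn // dvdn_mull // dvdn_even_pow.
Qed.

End PowersModSucc.

Section Continuants.

Variables (R : comNzRingType) (q : nat).

(* [(continuant Z j).2] is the Euler continuant of w, w^q, ..., w^(q^(2j-1)) and
   [w * (continuant Z j).1] that of w, ..., w^(q^(2j-2)), both written in terms
   of Z = w^(q+1). *)
Fixpoint continuant (Z : R) (j : nat) : R * R :=
  if j is i.+1 then
    let P := (continuant Z i).1 + Z ^+ ((q ^ i.*2 - 1) %/ q.+1) * (continuant Z i).2 in
    (P, (continuant Z i).2 + Z ^+ ((q ^ i.*2.+1 + 1) %/ q.+1) * P)
  else (0, 1).

(* For x = A + B and a = A * B in characteristic 2, [x ^+ (2 ^ e).+1 + dickson_tail x a e]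
   is the Dickson polynomial giving A^(2^e+1) + B^(2^e+1). *)
Fixpoint dickson_tail (x a : R) (e : nat) : R :=
  if e is i.+1 then x ^+ (2 ^ i) * dickson_tail x a i + a ^+ (2 ^ i) * x else 0.

(** The first step reaches 1 + Z, and every later step adds a multiple of Z^2. These low terms later
    give the divisibility of [P c] by f and its nonvanishing. *)
Lemma continuant_low (Z : R) (j : nat) : (1 < q)%N ->
  exists r, (continuant Z j.+1).2 = 1 + Z + Z ^+ 2 * r.
Proof.
move=> q1; elim: j => [|j [r hr]].
  exists 0 => /=; rewrite expn0 expn1 subnn div0n expr0 addn1 divnn /= expr1.
  by ring.
exists (r + Z ^+ ((q ^ j.+1.*2.+1 + 1) %/ q.+1 - 2) * (continuant Z j.+2).1).
rewrite -[LHS]/((continuant Z j.+1).2 + Z ^+ ((q ^ j.+1.*2.+1 + 1) %/ q.+1) * (continuant Z j.+2).1).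
rewrite hr; set E := (_ %/ _)%N; set P := (_.1).
have hE : (2 <= E)%N.
  rewrite leq_divRL // doubleS expnS expnS.
  have : (q <= q ^ j.*2.+1)%N by rewrite -{1}[q]expn1 leq_exp2l.
  by move: q1; nia.
by rewrite -{1}(subnKC hE) exprD; ring.
Qed.

Lemma dickson_tail_dvd (x y a : R) (e : nat) :
  exists r, dickson_tail x a e - dickson_tail y a e = (x - y) * r.
Proof.
elim: e => [|e [r hr]] /=; first by exists 0; rewrite subr0 mulr0.
exists (x ^+ (2 ^ e) * r +
  (\sum_(i < 2 ^ e) x ^+ ((2 ^ e).-1 - i) * y ^+ i) * dickson_tail y a e + a ^+ (2 ^ e)).
rewrite mulrDr mulrDr [(x - y) * (_ * dickson_tail _ _ _)]mulrA -subrXX.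
by rewrite [(x - y) * (_ * r)]mulrCA -hr; ring.
Qed.

End Continuants.

Lemma rmorph_continuant (R S : comNzRingType) (f : {rmorphism R -> S}) (q : nat) (Z : R) (j : nat) :
  continuant q (f Z) j = (f (continuant q Z j).1, f (continuant q Z j).2).
Proof.
elim: j => [|j /= ->] /=; first by rewrite rmorph0 rmorph1.
by rewrite !(rmorphD, rmorphM, rmorphXn).
Qed.

Lemma rmorph_dickson_tail (R S : comNzRingType) (f : {rmorphism R -> S}) (x a : R) (e : nat) :
  dickson_tail (f x) (f a) e = f (dickson_tail x a e).
Proof.
elim: e => [|e /= ->] /=; first by rewrite rmorph0.
by rewrite !(rmorphD, rmorphM, rmorphXn).
Qed.

Section CharTwo.

Variable R : comNzRingType.
Hypothesis ch2 : 2 \in [pchar R].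

Lemma exprD_2pow (x y : R) (k : nat) : (x + y) ^+ (2 ^ k) = x ^+ (2 ^ k) + y ^+ (2 ^ k).
Proof. by rewrite exprDn_pchar // pnatX pnatE // ch2. Qed.

Lemma dickson_tailE (x y : R) (e : nat) :
  x ^+ (2 ^ e) * y + x * y ^+ (2 ^ e) = dickson_tail (x + y) (x * y) e.
Proof.
elim: e => [|e IH] /=; first by rewrite !expr1 addrr_pchar2.
rewrite -IH exprD_2pow expnS mul2n -addnn !exprD exprMn.
set X := x ^+ _; set Y := y ^+ _.
have -> : (X + Y) * (X * y + x * Y) + X * Y * (x + y)
   = X * X * y + x * (Y * Y) + (X * Y * (x + y) + X * Y * (x + y)) by ring.
by rewrite addrr_pchar2 // addr0.
Qed.

Section Twisted.

Variables (e : nat) (u v w : R).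
Let q := (2 ^ e)%N.
Hypothesis huv : u ^+ q.+1 + v ^+ q.+1 = 1.
Hypothesis hu : u ^+ (q ^ 2) + u = w * v ^+ q.
Hypothesis hv : v ^+ (q ^ 2) + v = w * u ^+ q.

Lemma frob_add (x y : R) (k : nat) : (x + y) ^+ (q ^ k) = x ^+ (q ^ k) + y ^+ (q ^ k).
Proof. by rewrite /q -expnM exprD_2pow. Qed.

Lemma frob_step (x y : R) (k : nat) : x ^+ (q ^ 2) + x = w * y ^+ q ->
  x ^+ (q ^ k.+2) = x ^+ (q ^ k) + w ^+ (q ^ k) * y ^+ (q ^ k.+1).
Proof.
move=> h; have := congr1 (fun a => a ^+ (q ^ k)) h.
rewrite frob_add exprMn -!exprM -expnD -expnS [(2 + k)%N]addnC addn2 => <-.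
by rewrite addrCA addrr_pchar2 // addr0.
Qed.

(** [frob_step] lowers a Frobenius exponent by two at the cost of a term w^(q^k) y^(q^(k+1)). This
    is the recursion of [continuant], the surplus powers of w being powers of Z = w^(q+1). *)
Lemma continuantE (j : nat) :
  u * v ^+ (q ^ j.*2) + v * u ^+ (q ^ j.*2) = w * (continuant q (w ^+ q.+1) j).1 /\
  u * u ^+ (q ^ j.*2.+1) + v * v ^+ (q ^ j.*2.+1) = (continuant q (w ^+ q.+1) j).2.
Proof.
have q0 : (0 < q)%N by rewrite expn_gt0.
elim: j => [|j [IH1 IH2]].
  by rewrite /= expn0 !expn1 !expr1 mulr0 [v * u]mulrC addrr_pchar2 // -!exprS.
have h1 : u * v ^+ (q ^ j.+1.*2) + v * u ^+ (q ^ j.+1.*2) = w * (continuant q (w ^+ q.+1) j.+1).1.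
  rewrite doubleS (frob_step _ hv) (frob_step _ hu).
  rewrite -[X in _ = w * X]/((continuant q (w ^+ q.+1) j).1 +
    (w ^+ q.+1) ^+ ((q ^ j.*2 - 1) %/ q.+1) * (continuant q (w ^+ q.+1) j).2).
  rewrite -exprM [(q.+1 * _)%N]mulnC divnK ?dvdn_even_pow // [w * (_ + _)]mulrDr -IH1 -IH2 mulrA -exprS.
  by rewrite subn1 prednK ?expn_gt0 ?q0 //; ring.
split=> //; rewrite doubleS (frob_step j.*2.+1 hu) (frob_step j.*2.+1 hv).
rewrite -[RHS]/((continuant q (w ^+ q.+1) j).2 +
   (w ^+ q.+1) ^+ ((q ^ j.*2.+1 + 1) %/ q.+1) * (continuant q (w ^+ q.+1) j.+1).1).
rewrite -exprM [(q.+1 * _)%N]mulnC divnK ?dvdn_odd_pow // addn1 [_ ^+ (q ^ _).+1]exprSr -mulrA -h1 -IH2 doubleS.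
by ring.
Qed.

End Twisted.
End CharTwo.

(** * The fibers of t *)

Section FiberPolynomial.

Variables (F : fieldType) (q : nat).

(* In characteristic 2 this is (X^(q-1) + 1) / (X + 1). *)
Definition ratio_poly : {poly F} := \sum_(i < q.-1) 'X^i.

Definition fiber_poly : {poly F} := ('X^2 + 'X) * ratio_poly ^+ q.+1.

Hypothesis ch2 : 2 \in [pchar F].
Hypothesis q0 : (0 < q)%N.

Lemma pchar_poly2 : 2 \in [pchar {poly F}].
Proof. exact: (rmorph_pchar polyC). Qed.

Lemma ratio_polyE : ('X^2 + 'X) * ratio_poly = 'X^q + 'X.
Proof.
have hq : 'X^q = 'X * 'X^(q.-1) :> {poly F} by rewrite -exprS prednK.
have h := subrX1 ('X : {poly F}) q.-1.
rewrite !(GRing.subr_pchar2 pchar_poly2) in h.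
have -> : 'X^2 + 'X = 'X * ('X + 1) :> {poly F} by ring.
by rewrite -mulrA -h mulrDr -hq mulr1.
Qed.

Lemma ratio_poly_horner (t : F) : (t ^+ 2 + t) * ratio_poly.[t] = t ^+ q + t.
Proof. by have := congr1 (horner^~ t) ratio_polyE; rewrite /= !hornerE. Qed.

Lemma fiber_poly_horner (t : F) :
  fiber_poly.[t] = (t ^+ 2 + t) * ratio_poly.[t] ^+ q.+1.
Proof. by rewrite /fiber_poly !hornerE. Qed.

(** This exhibits f(t) as a (q+1)-th power divided by (t^2 + t)^q. It identifies f(t) with w^(q+1)
    below, and later transfers (q+1)-th powers from t^2 + t to f(t). *)
Lemma fiber_poly_frac (t : F) :
  fiber_poly.[t] * (t ^+ 2 + t) ^+ q = (t ^+ q + t) ^+ q.+1.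
Proof. by rewrite fiber_poly_horner -ratio_poly_horner exprMn [_ ^+ q.+1 in RHS]exprS; ring. Qed.

End FiberPolynomial.

Section Reciprocity.

Variables (F : countFieldType) (e j : nat).
Let q := (2 ^ e)%N.
Let n := j.*2.+1.
Let M := ((q ^ n + 1) %/ q.+1)%N.
Hypothesis ch2 : 2 \in [pchar F].

(* With u^(q+1) = t and v^(q+1) = 1 + t in an algebraic closure, A = u * u^(q^n) and
   B = v * v^(q^n), the sum A + B is a continuant in f(t), A * B is (t^2+t)^M, and
   A^(q+1) + B^(q+1) = 1 + t + t^(q^n). *)
Lemma fiber_reciprocity (t : F) : t ^+ q != t ->
  t + t ^+ (q ^ n) = 1 + (continuant q (fiber_poly F q).[t] j).2 ^+ q.+1
    + dickson_tail (continuant q (fiber_poly F q).[t] j).2 ((t ^+ 2 + t) ^+ M) e.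
Proof.
move=> ht; have q0 : (0 < q)%N by rewrite expn_gt0.
have [K [phi _]] := countable_algebraic_closure F.
have chK : 2 \in [pchar K] by rewrite (fmorph_pchar phi).
have [u hu] : exists u : K, u ^+ q.+1 = phi t.
  have [u hu] := @solve_monicpoly K q.+1 (fun i => if i == 0 then phi t else 0) isT.
  exists u; rewrite hu big_ord_recl /= mulr1 big1 ?addr0 // => i _.
  by rewrite mul0r.
have [v hv] : exists u : K, u ^+ q.+1 = 1 + phi t.
  have [v hv] := @solve_monicpoly K q.+1 (fun i => if i == 0 then 1 + phi t else 0) isT.
  exists v; rewrite hv big_ord_recl /= mulr1 big1 ?addr0 // => i _.
  by rewrite mul0r.
have addbb := addrr_pchar2 chK.
have addK (a b : K) : (a + b = 0) -> a = b.
  by move=> h; rewrite -[a]addr0 -(addbb b) addrA h add0r.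
have addKF (a b : F) : (a + b = 0) -> a = b.
  by move=> h; rewrite -[a]addr0 -(addrr_pchar2 ch2 b) addrA h add0r.
have tt0 : phi t != 0.
  by rewrite fmorph_eq0; apply: contraNneq ht => ->; rewrite expr0n (gtn_eqF q0).
have tt1 : 1 + phi t != 0.
  rewrite -(rmorph1 phi) -rmorphD fmorph_eq0; apply: contraNneq ht => /addKF <-.
  by rewrite expr1n.
have u0 : u != 0 by apply: contraNneq tt0 => h; rewrite -hu h expr0n.
have v0 : v != 0 by apply: contraNneq tt1 => h; rewrite -hv h expr0n.
have huv : u ^+ q.+1 + v ^+ q.+1 = 1 by rewrite hu hv addrCA addbb addr0.
pose w := (u ^+ (q ^ 2) + u) / v ^+ q.
have hw1 : u ^+ (q ^ 2) + u = w * v ^+ q by rewrite /w divfK // expf_neq0.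
(* The relation u^(q+1) + v^(q+1) = 1 added to its own q-th power. The first twisted equation
   defines w, and this one turns it into the second. *)
have key : u ^+ q * (u ^+ (q ^ 2) + u) = v ^+ q * (v ^+ (q ^ 2) + v).
  have h2 := congr1 (fun x => x ^+ q) huv.
  rewrite exprD_2pow // expr1n in h2.
  have hq (x : K) : (x ^+ q.+1) ^+ q = x ^+ q * x ^+ (q ^ 2).
    by rewrite -exprM mulSn exprD mulnn.
  rewrite !hq in h2; apply: addK.
  rewrite !mulrDr -!exprSr addrACA h2 huv; exact: addbb.
have hw2 : v ^+ (q ^ 2) + v = w * u ^+ q.
  apply: (mulfI (expf_neq0 q v0)); rewrite -key hw1; ring.
have huvq : phi (t ^+ 2 + t) = (u * v) ^+ q.+1.
  by rewrite exprMn hu hv rmorphD rmorphXn; ring.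
have hw : w ^+ q.+1 = phi (fiber_poly F q).[t].
  (* Indeed t^q + t = u^q (u^(q^2) + u); its (q+1)-th power is compared with [fiber_poly_frac]. *)
  have hT : phi (t ^+ q + t) = w * (u * v) ^+ q.
    rewrite rmorphD rmorphXn -hu -exprM mulSn exprD mulnn exprSr -mulrDr hw1 exprMn; ring.
  have := congr1 phi (fiber_poly_frac ch2 q0 t).
  rewrite rmorphM !rmorphXn huvq hT [(w * _) ^+ _]exprMn -!exprM [(q * _)%N]mulnC => h.
  by apply/esym/(mulIf _ h); rewrite expf_neq0 // mulf_neq0.
have [_ hc] := continuantE chK huv hw1 hw2 j.
have cofactor_mul : (q.+1 * M = q ^ n + 1)%N by rewrite mulnC divnK // dvdn_odd_pow.
apply: (fmorph_inj phi).
pose x := (continuant q (fiber_poly F q).[t] j).2.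
rewrite -/x !(rmorphD, rmorphXn) rmorph1 -rmorph_dickson_tail.
have -> : phi x = u * u ^+ (q ^ n) + v * v ^+ (q ^ n).
  by rewrite hc hw rmorph_continuant.
rewrite rmorphXn huvq -exprM cofactor_mul addn1.
set A := u * _; set B := v * _.
have -> : (u * v) ^+ (q ^ n).+1 = A * B by rewrite exprMn !exprS /A /B; ring.
rewrite -dickson_tailE // !exprSr.
rewrite exprD_2pow // -/q.
(* The Dickson tail equals the mixed terms of (A + B)^(q+1), so they cancel. *)
have -> : 1 + (A ^+ q + B ^+ q) * (A + B) + (A ^+ q * B + A * B ^+ q) =
  1 + A ^+ q.+1 + B ^+ q.+1 + (A ^+ q * B + A * B ^+ q + (A ^+ q * B + A * B ^+ q)).
  by rewrite !exprSr; ring.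
rewrite addbb addr0.
have hA : A ^+ q.+1 = phi t * phi t ^+ (q ^ n).
  by rewrite exprMn hu exprAC hu.
have hB : B ^+ q.+1 = (1 + phi t) * (1 + phi t) ^+ (q ^ n).
  by rewrite exprMn hv exprAC hv.
rewrite hA hB frob_add // expr1n.
set T := phi t; set T' := T ^+ _.
have -> : 1 + T * T' + (1 + T) * (1 + T') = T + T' + (1 + 1) * (1 + T * T') by ring.
by rewrite addbb mul0r addr0.
Qed.

End Reciprocity.

(** * Degrees of continuants and Dickson tails of polynomials *)

Section DegreeBounds.

Variable F : fieldType.
Implicit Types p r x a : {poly F}.

Lemma size_add_leq d p r :
  (size p <= d)%N -> (size r <= d)%N -> (size (p + r)%R <= d)%N.
Proof. by move=> hp hr; apply: leq_trans (size_polyD _ _) _; rewrite geq_max hp. Qed.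

Lemma size_mul_leqS d1 d2 p r :
  (size p <= d1.+1)%N -> (size r <= d2.+1)%N -> (size (p * r)%R <= (d1 + d2).+1)%N.
Proof. by move=> hp hr; apply: leq_trans (size_polyMleq _ _) _; lia. Qed.

Lemma size_exp_leqS d k p : (size p <= d.+1)%N -> (size (p ^+ k)%R <= (d * k).+1)%N.
Proof.
move=> hp; apply: leq_trans (size_poly_exp_leq _ _) _.
by rewrite ltnS leq_mul2r; apply/orP; right; lia.
Qed.

(** Here t = 1 + q^2 + ... + q^(2j-2) bounds the degree in Z of the second component. In terms of t
    the exponents of the next step are (q-1) t and q (q-1) t + 1. *)
Lemma size_continuant (q D j : nat) (Z : {poly F}) :
  (1 < q)%N -> (size Z <= D.+1)%N ->
  exists t, [/\ (t * (q ^ 2 - 1) + 1 = q ^ j.*2)%N,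
    (size (continuant q Z j).1 <= (D * (q * t)).+1)%N &
    (size (continuant q Z j).2 <= (D * t).+1)%N].
Proof.
move=> q1 hZ; elim: j => [|j [t [ht h1 h2]]].
  by exists 0; rewrite /= mul0n size_poly0 size_poly1 muln0.
have hq2 : (q ^ 2 - 1 = (q - 1) * q.+1)%N by rewrite -[q.+1]addn1 -subn_sqr.
have hE1 : ((q ^ j.*2 - 1) %/ q.+1 = (q - 1) * t)%N.
  by rewrite -ht addnK hq2 mulnA mulnK // mulnC.
have hE2 : ((q ^ j.*2.+1 + 1) %/ q.+1 = q * (q - 1) * t + 1)%N.
  have -> : (q ^ j.*2.+1 + 1 = (q * (q - 1) * t + 1) * q.+1)%N.
    by rewrite expnS -ht hq2; ring.
  by rewrite mulnK.
(* This keeps the t of step j, as the second component needs q (q-1) t + 1 + q t = q^2 t + 1. *)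
have s1 : (size (continuant q Z j.+1).1 <= (D * (q * t)).+1)%N.
  apply: size_add_leq => //; rewrite hE1.
  have -> : (D * (q * t) = D * ((q - 1) * t) + D * t)%N.
    by rewrite -mulnDr -{3}[t]mul1n -mulnDl subnK // ltnW.
  by apply: size_mul_leqS => //; apply: size_exp_leqS.
have tle : (t <= q ^ 2 * t + 1)%N.
  apply: (@leq_trans (q ^ 2 * t)); last exact: leq_addr.
  by rewrite leq_pmull // expn_gt0 ltnW.
exists (q ^ 2 * t + 1)%N; split.
- rewrite doubleS -[j.*2.+2]addn2 expnD -ht.
  have q2 : (0 < q ^ 2)%N by rewrite expn_gt0 ltnW.
  by move: (q ^ 2)%N q2; clear; case=> // k _; rewrite subn1 /=; ring.
- by apply: leq_trans s1 _; rewrite ltnS !leq_mul.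
apply: size_add_leq.
  by apply: leq_trans h2 _; rewrite ltnS leq_mul.
rewrite hE2; have -> : (D * (q ^ 2 * t + 1) = D * (q * (q - 1) * t + 1) + D * (q * t))%N.
  rewrite -mulnDr; congr (_ * _)%N; rewrite addnAC -mulnA -mulnDr.
  by rewrite -{3}[t]mul1n -mulnDl subnK ?(ltnW q1) // mulnA mulnn.
by apply: size_mul_leqS => //; apply: size_exp_leqS.
Qed.

(** The tail has weight 2^e + 1 when x has weight 1 and a weight 2. Each of its terms contains x,
    whose degree is below M, hence a degree strictly below (2^e + 1) M. *)
Lemma size_dickson_tail (M e : nat) x a :
  (size x <= M)%N -> (size a <= (2 * M).+1)%N -> (0 < M)%N ->
  (size (dickson_tail x a e) <= 2 ^ e * M + M)%N.
Proof.
case: M => // M hx ha _; elim: e => [|e IH] /=; first by rewrite size_poly0.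
have h2 : (0 < 2 ^ e)%N by rewrite expn_gt0.
apply: size_add_leq.
  have IH' : (size (dickson_tail x a e) <= (2 ^ e * M.+1 + M).+1)%N by rewrite -addnS.
  apply: leq_trans (size_mul_leqS (size_exp_leqS (2 ^ e) hx) IH') _.
  by rewrite expnS; nia.
apply: leq_trans (size_mul_leqS (size_exp_leqS (2 ^ e) ha) hx) _.
by rewrite expnS; nia.
Qed.

End DegreeBounds.

Lemma dickson_tail_factor (R : comNzRingType) (x a : R) (e : nat) :
  exists r, dickson_tail x a e = a * r.
Proof.
elim: e => [|e [r hr]] /=; first by exists 0; rewrite mulr0.
exists (x ^+ (2 ^ e) * r + a ^+ (2 ^ e).-1 * x).
by rewrite hr -[in a ^+ _](prednK (expn_gt0 2 e)) exprS; ring.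
Qed.

Section CharTwoPowers.

Variable R : comNzRingType.
Hypothesis ch2 : 2 \in [pchar R].

Lemma continuant_pow (q k j : nat) (Z : R) :
  continuant q (Z ^+ (2 ^ k)) j =
  ((continuant q Z j).1 ^+ (2 ^ k), (continuant q Z j).2 ^+ (2 ^ k)).
Proof.
elim: j => [|j /= ->] /=; first by rewrite expr0n expn_eq0 expr1n.
by rewrite !exprD_2pow // !exprMn !exprD_2pow // exprMn ![_ ^+ _ ^+ (2 ^ k)]exprAC.
Qed.

Lemma dickson_tail_pow (k e : nat) (x a : R) :
  dickson_tail (x ^+ (2 ^ k)) (a ^+ (2 ^ k)) e = dickson_tail x a e ^+ (2 ^ k).
Proof.
elim: e => [|e /= ->] /=; first by rewrite expr0n expn_eq0.
by rewrite exprD_2pow // !exprMn ![_ ^+ (2 ^ e) ^+ (2 ^ k)]exprAC.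
Qed.

End CharTwoPowers.

Section FiberSize.

Variables (F : fieldType) (q : nat).
Hypothesis ch2 : 2 \in [pchar F].
Hypothesis q1 : (1 < q)%N.

Lemma X2X_factor : 'X^2 + 'X = 'X * ('X + 1) :> {poly F}.
Proof. by ring. Qed.

Lemma X1_neq0 : 'X + 1 != 0 :> {poly F}.
Proof. by rewrite -size_poly_eq0 -polyC1 size_XaddC. Qed.

Lemma X2X_neq0 : 'X^2 + 'X != 0 :> {poly F}.
Proof. by rewrite X2X_factor mulf_neq0 ?polyX_eq0 ?X1_neq0. Qed.

Lemma size_X2X : size ('X^2 + 'X : {poly F}) = 3%N.
Proof. by rewrite size_polyDl size_polyXn // size_polyX. Qed.

Lemma size_XqX : size ('X^q + 'X : {poly F}) = q.+1.
Proof. by rewrite size_polyDl size_polyXn // size_polyX. Qed.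

Lemma ratio_poly_neq0 : ratio_poly F q != 0.
Proof.
have := ratio_polyE ch2 (ltnW q1); apply: contra_eq_neq => ->.
by rewrite mulr0 eq_sym -size_poly_eq0 size_XqX.
Qed.

Lemma size_ratio_poly : size (ratio_poly F q) = q.-1.
Proof.
have : size (('X^2 + 'X) * ratio_poly F q) = q.+1.
  by rewrite ratio_polyE ?(ltnW q1) // size_XqX.
rewrite size_mul ?X2X_neq0 ?ratio_poly_neq0 // size_X2X => h.
by have : (size (ratio_poly F q)).+2 = q.+1 := h; lia.
Qed.

Lemma fiber_poly_neq0 : fiber_poly F q != 0.
Proof. by rewrite mulf_neq0 ?X2X_neq0 ?expf_neq0 ?ratio_poly_neq0. Qed.

Lemma size_fiber_poly : size (fiber_poly F q) = (q ^ 2 - q).+1.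
Proof.
have r0 : ratio_poly F q ^+ q.+1 != 0 by rewrite expf_neq0 ?ratio_poly_neq0.
have : (size (ratio_poly F q ^+ q.+1)).-1 = (q.-2 * q.+1)%N.
  by rewrite size_exp size_ratio_poly.
move: r0; rewrite -size_poly_gt0 size_mul ?X2X_neq0 ?expf_neq0 ?ratio_poly_neq0 // size_X2X.
case: (size (ratio_poly F q ^+ q.+1)) => // s _ /= ->; move: q1; case: q => [|[|k]] // _.
by rewrite -mulnn; nia.
Qed.

(** f vanishes simply at 0 with derivative 1; the coefficient of t will separate different values of
    c. *)
Lemma fiber_polyX : exists2 g, fiber_poly F q = 'X * g & g.[0] = 1.
Proof.
exists (('X + 1) * ratio_poly F q ^+ q.+1).
  by rewrite /fiber_poly X2X_factor mulrA.
have h : ('X + 1) * ratio_poly F q = 'X^(q.-1) + 1.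
  apply: (mulfI (negbT (polyX_eq0 F))); rewrite mulrA -X2X_factor ratio_polyE ?(ltnW q1) //.
  by rewrite mulrDr mulr1 -exprS prednK // ltnW.
have := congr1 (fun p : {poly F} => p.[0]) h.
rewrite !hornerE expr0n; have -> : (q.-1 == 0)%N = false by lia.
by rewrite add0r => ->; rewrite expr1n.
Qed.

Lemma fiber_poly_eq0 (t : F) : (fiber_poly F q).[t] = 0 -> t ^+ q = t.
Proof.
move=> h; have := fiber_poly_frac ch2 (ltnW q1) t; rewrite h mul0r => /esym/eqP.
rewrite expf_eq0 /= addr_eq0 => /eqP ->; by rewrite oppr_pchar2.
Qed.

End FiberSize.

(** * The number of t with f(t)^(q^n) = c f(t) *)

Section FiberBound.

Variables (F : finFieldType) (e j : nat).
Let q := (2 ^ e)%N.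
Let n := j.+1.*2.+1.
Let M := ((q ^ n + 1) %/ q.+1)%N.
Hypothesis e0 : (0 < e)%N.
Hypothesis hF : #|F| = (q ^ (2 * n))%N.

Lemma pchar2_card : 2 \in [pchar F].
Proof. by apply: (@card_finPcharP _ 2 (e * (2 * n))) => //; rewrite hF -expnM. Qed.
Let ch2 := pchar2_card.

(* The right-hand side of [fiber_reciprocity] as a polynomial in t, once with f and once with
   c * f in place of f^(q^n); their difference [P c] has degree at most q^n, is divisible by f
   and vanishes on [twisted_fiber c]. *)
Let trace_form (a x : {poly F}) := x ^+ q.+1 + dickson_tail x a e.
Let xpol (c : F) := (continuant q (c%:P * fiber_poly F q) j.+1).2.
Let apol : {poly F} := ('X^2 + 'X) ^+ M.
Let P (c : F) := trace_form apol (xpol 1) - trace_form apol (xpol c).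

Lemma q_gt1 : (1 < q)%N.
Proof. by rewrite /q -{1}[1%N](expn0 2) ltn_exp2l. Qed.
Let q1 := q_gt1.

Lemma cofactor_mul : (q.+1 * M = q ^ n + 1)%N.
Proof. by rewrite mulnC divnK // dvdn_odd_pow // ltnW. Qed.

Lemma cofactor_gt1 : (1 < M)%N.
Proof.
have : (q ^ 2 < q ^ n)%N by rewrite ltn_exp2l.
by have := cofactor_mul; rewrite -mulnn; nia.
Qed.

(** The continuant has degree at most (q^2 - q) t with t = (q^(n-1) - 1) / (q^2 - 1), and this is
    exactly M - 1. *)
Lemma size_xpol (c : F) : (size (xpol c) <= M)%N.
Proof.
have hs : (size (c%:P * fiber_poly F q)%R <= (q ^ 2 - q).+1)%N.
  by apply: leq_trans (size_polyMleq _ _) _; rewrite size_fiber_poly // size_polyC; lia.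
have [t [ht _ h]] := size_continuant j.+1 q1 hs.
apply: leq_trans h _.
have hq : (q ^ n = q * (t * (q ^ 2 - 1) + 1))%N by rewrite /n expnS ht.
have hM' := cofactor_mul; rewrite hq in hM'.
have e1 : (q.+1 * ((q ^ 2 - q) * t).+1 = q * (t * (q ^ 2 - 1) + 1) + 1)%N.
  rewrite -mulnn; have := q1; clear; case: q => // k _.
  have -> : (k.+1 * k.+1 - k.+1 = k.+1 * k)%N by lia.
  have -> : (k.+1 * k.+1 - 1 = k * k.+2)%N by lia.
  by ring.
by rewrite -(@leq_pmul2l q.+1) // e1 hM'.
Qed.

(** Both parts of the trace form have degree below (q + 1) M = q^n + 1. *)
Lemma size_fiber_diff (c : F) : (size (P c) <= (q ^ n).+1)%N.
Proof.
have hform (x : {poly F}) : (size x <= M)%N -> (size (trace_form apol x) <= (q ^ n).+1)%N.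
  have M1 := cofactor_gt1 => hx; have hM' := cofactor_mul.
  have hx' : (size x <= (M.-1).+1)%N by rewrite prednK // ltnW.
  apply: size_add_leq.
    by apply: leq_trans (size_exp_leqS _ hx') _; nia.
  have ha : (size apol <= (2 * M).+1)%N by apply: size_exp_leqS; rewrite size_X2X.
  by apply: leq_trans (size_dickson_tail e hx ha (ltnW M1)) _; rewrite -/q; nia.
by apply: size_add_leq; rewrite ?size_polyN; apply: hform; apply: size_xpol.
Qed.

(** Both continuants are 1 modulo f, and the two trace forms are the same polynomial expression in
    them with a common second argument. *)
Lemma fiber_diff_dvd (c : F) : exists g, P c = fiber_poly F q * g.
Proof.
have [r1 h1] := continuant_low (1%:P * fiber_poly F q) j q1.
have [rc hc] := continuant_low (c%:P * fiber_poly F q) j q1.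
have [s hs] := dickson_tail_dvd (xpol 1) (xpol c) apol e.
pose d := 1%:P - c%:P + fiber_poly F q * (1%:P ^+ 2 * r1 - c%:P ^+ 2 * rc).
have hd : xpol 1 - xpol c = fiber_poly F q * d.
  by rewrite /xpol h1 hc /d; ring.
have hX := subrXX (xpol 1) (xpol c) q.+1.
exists (d * (\sum_(i < q.+1) xpol 1 ^+ (q.+1.-1 - i) * xpol c ^+ i) + d * s).
by rewrite /P /trace_form opprD addrACA hX hs hd; ring.
Qed.

(** Modulo t^2 the trace form of [xpol b] is 1 + b t: the q-th power has no linear term, and the
    Dickson tail is a multiple of (t^2 + t)^M with M at least 2. So the coefficient of t in [P c] is
    1 - c. *)
Lemma fiber_diff_neq0 (c : F) : c != 1 -> P c != 0.
Proof.
move=> c1; have [g hg g0] := fiber_polyX ch2 q1.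
have M1 := cofactor_gt1.
have hform b : exists r, trace_form apol (xpol b) = 1 + b%:P * 'X * g + 'X^2 * r.
  have [r hr] := continuant_low (b%:P * fiber_poly F q) j q1.
  have [s hs] := dickson_tail_factor (xpol b) apol e.
  have hx : xpol b = 1 + b%:P * 'X * g + 'X^2 * (b%:P ^+ 2 * g ^+ 2 * r).
    by rewrite -[LHS]/((continuant q (b%:P * fiber_poly F q) j.+1).2) hr hg; ring.
  pose k := b%:P * g + 'X * (b%:P ^+ 2 * g ^+ 2 * r).
  have hxq : xpol b ^+ q = 1 + 'X^2 * ('X^(q - 2) * k ^+ q).
    have -> : xpol b = 1 + 'X * k by rewrite hx /k; ring.
    by rewrite exprD_2pow ?pchar_poly2 // expr1n exprMn mulrA -exprD subnKC.
  have ha : apol = 'X^2 * ('X^(M - 2) * ('X + 1) ^+ M).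
    by rewrite /apol X2X_factor exprMn mulrA -exprD subnKC.
  exists ('X^(q - 2) * k ^+ q * xpol b + b%:P ^+ 2 * g ^+ 2 * r + 'X^(M - 2) * ('X + 1) ^+ M * s).
  by rewrite /trace_form hs exprSr hxq ha mulrDl mul1r {1}hx; ring.
have [r1 h1] := hform 1; have [rc hc] := hform c.
rewrite /P h1 hc; apply: contra_neq c1 => h0.
have : 'X * ((1%:P - c%:P) * g + 'X * (r1 - rc)) = 0 :> {poly F} by rewrite -h0; ring.
move/eqP; rewrite mulf_eq0 polyX_eq0 /= => /eqP/(congr1 (fun p : {poly F} => p.[0])).
by rewrite !hornerE g0 mulr1 => /eqP; rewrite subr_eq0 => /eqP.
Qed.

(** The element t + t^(q^n) is fixed by the q^n-th power map. Raising the reciprocity formula to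
    that power replaces f(t) by c f(t) and keeps (t^2 + t)^M. *)
Lemma root_fiber_diff (c t : F) :
  t ^+ q != t -> (fiber_poly F q).[t] ^+ (q ^ n) = c * (fiber_poly F q).[t] ->
  ((t ^+ 2 + t) ^+ M) ^+ (q ^ n) = (t ^+ 2 + t) ^+ M -> root (P c) t.
Proof.
move=> ht hf hY.
have hx b : (xpol b).[t] = (continuant q (b * (fiber_poly F q).[t]) j.+1).2.
  have -> : b * (fiber_poly F q).[t] = horner_eval t (b%:P * fiber_poly F q).
    by rewrite /horner_eval !hornerE.
  by rewrite rmorph_continuant.
have hform b : (trace_form apol (xpol b)).[t] =
    (xpol b).[t] ^+ q.+1 + dickson_tail (xpol b).[t] ((t ^+ 2 + t) ^+ M) e.
  have ha : apol.[t] = (t ^+ 2 + t) ^+ M by rewrite /apol !hornerE.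
  rewrite /trace_form hornerD horner_exp -ha; congr (_ + _).
  exact: (esym (rmorph_dickson_tail (horner_eval t) (xpol b) apol e)).
have hrec := @fiber_reciprocity F e j.+1 ch2 t ht.
rewrite rootE /P hornerD hornerN !hform !hx mul1r -hf.
rewrite -/q -/n -/M in hrec.
set x := (continuant q (fiber_poly F q).[t] j.+1).2 in hrec *.
have hqn : (q ^ n = 2 ^ (e * n))%N by rewrite expnM.
have -> : (continuant q ((fiber_poly F q).[t] ^+ (q ^ n)) j.+1).2 = x ^+ (q ^ n).
  by rewrite hqn continuant_pow.
rewrite -[in dickson_tail (x ^+ _) _ _]hY hqn dickson_tail_pow // exprAC -exprD_2pow // -hqn.
have -> : x ^+ q.+1 + dickson_tail x ((t ^+ 2 + t) ^+ M) e = 1 + (t + t ^+ (q ^ n)).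
  by rewrite hrec addrA addrA addrr_pchar2 // add0r.
rewrite frob_add // frob_add // expr1n -exprM -expnD addnn -mul2n -hF expf_card.
by rewrite [X in _ - (_ + X)]addrC subrr.
Qed.

Definition twisted_fiber (c : F) : {set F} :=
  [set t : F | [&& t ^+ q != t, (fiber_poly F q).[t] ^+ (q ^ n) == c * (fiber_poly F q).[t]
      & ((t ^+ 2 + t) ^+ M) ^+ (q ^ n) == (t ^+ 2 + t) ^+ M]].

(** The zeros of f satisfy t^q = t and are excluded, so only the roots of [P c] divided by f count;
    this saves the degree q^2 - q of f. *)
Lemma card_twisted_fiber (c : F) : c != 1 ->
  (#|twisted_fiber c| <= q ^ n - (q ^ 2 - q))%N.
Proof.
move=> c1; have [g hg] := fiber_diff_dvd c.
have P0 := fiber_diff_neq0 c1.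
have g0 : g != 0 by apply: contraNneq P0 => g0; rewrite hg g0 mulr0.
have hs := size_fiber_diff c.
rewrite hg size_mul ?fiber_poly_neq0 // size_fiber_poly // addSn /= in hs.
have hroot : (#|twisted_fiber c| < size g)%N.
  apply: card_root_lt => // t; rewrite inE => /and3P[ht /eqP hf /eqP hY].
  have := root_fiber_diff ht hf hY; rewrite hg rootM => /orP[|//].
  by rewrite rootE => /eqP /(fiber_poly_eq0 ch2 q1) h; rewrite h eqxx in ht.
have {}hs : (q ^ 2 - q + size g <= (q ^ n).+1)%N := hs.
by lia.
Qed.

End FiberBound.

(** * Points of t^2 + t = y^(q+1) *)

Section ArtinSchreier.

Variable F : finFieldType.
Hypothesis ch2 : 2 \in [pchar F].

Definition as_image : {set F} := [set x ^+ 2 + x | x : F].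

Lemma mem_as_image (x : F) : x ^+ 2 + x \in as_image.
Proof. by apply/imsetP; exists x. Qed.

(** The additive character (-1)^Tr(x), Tr being the trace to the field with two elements, whose
    kernel is [as_image]. *)
Definition as_char (x : F) : int := if x \in as_image then 1 else -1.

Lemma sqrD2 (x y : F) : (x + y) ^+ 2 = x ^+ 2 + y ^+ 2.
Proof. exact: (exprD_2pow ch2 x y 1). Qed.

Lemma as_fiberE (s t : F) : (s ^+ 2 + s == t ^+ 2 + t) = (s == t) || (s == t + 1).
Proof.
have -> : (s ^+ 2 + s == t ^+ 2 + t) = ((s - t) * (s - (t + 1)) == 0).
  rewrite -subr_eq0; congr (_ == 0).
  have h2 : (1 + 1 : F) = 0 by rewrite addrr_pchar2.
  have -> : s ^+ 2 + s - (t ^+ 2 + t) = (s - t) * (s - (t + 1)) + (1 + 1) * ((1 + t) * (s - t)) by ring.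
  by rewrite h2 mul0r addr0.
by rewrite mulf_eq0 !subr_eq0.
Qed.

Lemma card_as_fiber (a : F) :
  #|[set t : F | t ^+ 2 + t == a]| = if a \in as_image then 2%N else 0%N.
Proof.
case: ifP => [/imsetP[s _ ->]|/negP ha]; last first.
  apply/eqP; rewrite cards_eq0; apply/eqP/setP => t; rewrite !inE.
  by apply/negbTE/eqP => ht; apply: ha; apply/imsetP; exists t.
have -> : [set t | t ^+ 2 + t == s ^+ 2 + s] = [set s; s + 1].
  by apply/setP => t; rewrite !inE as_fiberE.
rewrite cards2; have -> // : s != s + 1.
by rewrite eq_sym -subr_eq0 addrC addKr oner_eq0.
Qed.

Lemma card_as_image : (2 * #|as_image| = #|F|)%N.
Proof.
rewrite -cardsT -[RHS]sum1_card [RHS](partition_big (fun t : F => t ^+ 2 + t) (mem as_image)) /=; last first.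
  by move=> t _; apply: imset_f.
rewrite mulnC -sum_nat_const; apply: eq_bigr => a ha.
transitivity #|[set t : F | t ^+ 2 + t == a]|; first by rewrite card_as_fiber ha.
by rewrite -sum1_card; apply: eq_bigl => t; rewrite !inE.
Qed.

Lemma as_imageD (x y : F) : x \in as_image -> (x + y \in as_image) = (y \in as_image).
Proof.
move=> hx; have hD a b : a \in as_image -> b \in as_image -> a + b \in as_image.
  move=> /imsetP[s _ ->] /imsetP[t _ ->]; apply/imsetP; exists (s + t) => //.
  by rewrite sqrD2 addrACA.
apply/idP/idP => h; last exact: hD.
by rewrite -[y]add0r -(addrr_pchar2 ch2 x) -addrA; apply: hD.
Qed.

(** The image has index 2, so its complement is a single coset. *)
Lemma as_imageD_out (x y : F) :
  x \notin as_image -> y \notin as_image -> x + y \in as_image.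
Proof.
move=> hx hy.
have hsub : +%R x @: as_image = ~: as_image.
  apply/eqP; rewrite eqEcard card_imset; last exact: addrI.
  rewrite [leqLHS]cardsCs setCK -card_as_image mul2n -addnn addnK leqnn andbT.
  apply/subsetP => z /imsetP[a ha ->]; rewrite inE addrC as_imageD //.
have : y \in ~: as_image by rewrite inE.
by rewrite -hsub => /imsetP[a ha ->]; rewrite addrA addrr_pchar2 // add0r.
Qed.

Lemma as_charD (x y : F) : as_char (x + y) = as_char x * as_char y.
Proof.
rewrite /as_char; case: (boolP (x \in as_image)) => hx.
  by rewrite as_imageD // mul1r.
case: (boolP (y \in as_image)) => hy; last by rewrite as_imageD_out // mulrNN mulr1.
by rewrite addrC as_imageD // (negbTE hx) mulr1.
Qed.

Lemma as_char_sqr (x : F) : as_char x * as_char x = 1.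
Proof. by rewrite /as_char; case: ifP. Qed.

Lemma as_char_pow2 (x : F) (i : nat) : as_char (x ^+ (2 ^ i)) = as_char x.
Proof.
elim: i => [|i IH]; first by rewrite expr1.
rewrite expnS mulnC exprM -IH; set y := x ^+ _.
have -> : y ^+ 2 = (y ^+ 2 + y) + y by rewrite -addrA addrr_pchar2 // addr0.
by rewrite as_charD {1}/as_char mem_as_image mul1r.
Qed.

Lemma sum_as_char : \sum_(y : F) as_char y = 0.
Proof.
rewrite (bigID (mem as_image)) /=.
rewrite (eq_bigr (fun=> 1)) => [|y hy]; last by rewrite /as_char hy.
rewrite [X in _ + X](eq_bigr (fun=> -1)) => [|y hy]; last by rewrite /as_char (negbTE hy).
rewrite !sumr_const.
have -> : #|[pred i | i \notin as_image]| = #|as_image|.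
  have := cardC (mem as_image); rewrite -card_as_image.
  have -> : #|[predC (mem as_image)]| = #|[pred i | i \notin as_image]| by apply: eq_card.
  by rewrite mul2n -addnn => /addnI.
by rewrite mulNrn subrr.
Qed.

Lemma sum_as_charM (k : F) :
  \sum_(y : F) as_char (y * k) = if k == 0 then #|F|%:R else 0.
Proof.
case: eqVneq => [->|k0].
  rewrite (eq_bigr (fun=> 1)) ?sumr_const // => y _.
  by have := mem_as_image 0; rewrite mulr0 /as_char expr0n addr0 => ->.
by rewrite -[RHS]sum_as_char [RHS](reindex_inj (mulIf k0)).
Qed.

End ArtinSchreier.

Lemma card_pow_fixed (F : finFieldType) (k : nat) :
  (1 < k)%N -> (k.-1 %| #|F|.-1)%N -> #|[set x : F | x ^+ k == x]| = k.
Proof.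
move=> k1 hk; have k0 : (0 < k)%N by apply: ltnW.
have -> : [set x : F | x ^+ k == x] = 0 |: [set x | x ^+ k.-1 == 1].
  apply/setP => x; rewrite !inE; case: (eqVneq x 0) => [->|x0] /=.
    by rewrite expr0n (gtn_eqF k0) eqxx.
  have -> : x ^+ k = x * x ^+ k.-1 by rewrite -exprS prednK.
  by rewrite -[X in _ == X]mulr1 (inj_eq (mulfI x0)).
rewrite cardsU1 inE expr0n card_unity_root // gtn_eqF; last by case: k k1 {k0 hk} => [|[]].
by rewrite mulr0n eq_sym oner_eq0 /= add1n prednK.
Qed.

(** * The character sum over y^(q+1) *)

Section QuadraticSum.

Variables (F : finFieldType) (e n : nat).
Let q := (2 ^ e)%N.
Hypothesis e0 : (0 < e)%N.
Hypothesis n0 : (0 < n)%N.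
Hypothesis hn : odd n.
Hypothesis ch2 : 2 \in [pchar F].
Hypothesis hF : #|F| = (q ^ (2 * n))%N.

Let S : int := \sum_(y : F) as_char (y ^+ q.+1).

Let q1 : (1 < q)%N.
Proof. by rewrite /q -{1}[1%N](expn0 2) ltn_exp2l. Qed.

Lemma dvdn_pred_card (k : nat) : (k %| 2 * n)%N -> ((q ^ k).-1 %| #|F|.-1)%N.
Proof. by rewrite hF => /dvdnP[l ->]; rewrite mulnC expnM dvdn_pred_predX. Qed.

Lemma card_Fq : #|[set x : F | x ^+ q == x]| = q.
Proof. by apply: card_pow_fixed => //; have := @dvdn_pred_card 1; rewrite expn1; apply. Qed.

Lemma card_Fq2 : #|[set x : F | x ^+ (q ^ 2) == x]| = (q ^ 2)%N.
Proof.
apply: card_pow_fixed; last by rewrite dvdn_pred_card // dvdn_mulr.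
by rewrite -{1}[1%N](expn0 q) ltn_exp2l.
Qed.

Lemma frobq_inj : injective (fun x : F => x ^+ q).
Proof.
move=> x y /= h; apply/eqP; rewrite -subr_eq0.
have : (x - y) ^+ q == 0 by rewrite GRing.subr_pchar2 // exprD_2pow // h addrr_pchar2.
by rewrite expf_eq0 => /andP[].
Qed.

(** The norm z lies in the field with q elements. Some k in the field with q^2 elements has nonzero
    trace tau = k + k^q, so z = a + a^q for a = z k / tau, and a and a^q have the same character
    value. *)
Lemma as_char_norm (x : F) : x ^+ (q ^ 2) = x -> as_char (x ^+ q.+1) = 1.
Proof.
move=> hx; set z := x ^+ q.+1.
have hz : z ^+ q = z by rewrite /z -exprM mulSn exprD mulnn hx exprSr.
have [k hk kq] : exists2 k : F, k ^+ (q ^ 2) = k & k ^+ q != k.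
  have : ~~ ([set x : F | x ^+ (q ^ 2) == x] \subset [set x : F | x ^+ q == x]).
    apply/negP => /subset_leq_card; rewrite card_Fq card_Fq2 -mulnn.
    by rewrite leqNgt ltn_Pmull // ltnW.
  by case/subsetPn => k; rewrite !inE => /eqP h1 h2; exists k.
pose tau := k + k ^+ q.
have tau0 : tau != 0.
  by apply: contraNneq kq => /eqP; rewrite addr_eq0 oppr_pchar2 // eq_sym.
have htau : tau ^+ q = tau.
  by rewrite exprD_2pow // -/q -exprM mulnn hk addrC.
have -> : z = z * (k / tau) + (z * (k / tau)) ^+ q.
  rewrite exprMn expr_div_n htau hz -mulrDr -mulrDl -/tau divff ?mulr1 //.
by rewrite as_charD // as_char_pow2 // as_char_sqr.
Qed.

(* Modulo the image of z |-> z^2 + z one has y^q * x = y * x^(1/q), so the sum over y only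
   survives for x in the field with q^2 elements, where the character is trivial on norms. *)
Lemma quadratic_sum_sqr : S * S = (q%:R * (q ^ n)%:R) ^+ 2.
Proof.
have hx (x y : F) : as_char (y ^+ q.+1) * as_char ((y + x) ^+ q.+1) =
    as_char (x ^+ q.+1) * as_char (y * (x ^+ (q ^ (2 * n).-1) + x ^+ q)).
  rewrite -!as_charD //.
  have -> : y ^+ q.+1 + (y + x) ^+ q.+1 = x ^+ q.+1 + (y ^+ q * x + y * x ^+ q).
    rewrite !exprSr exprD_2pow // -/q. apply/eqP; rewrite -subr_eq0.
    have h2 : (1 + 1 : F) = 0 by rewrite addrr_pchar2.
    set Y := y ^+ q; set X := x ^+ q.
    have -> : Y * y + (Y + X) * (y + x) - (X * x + (Y * x + y * X)) = (1 + 1) * (Y * y) by ring.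
    by rewrite h2 mul0r.
  rewrite [LHS]as_charD // [RHS]as_charD // mulrDr; congr (_ * _).
  rewrite !as_charD //; congr (_ * _).
  rewrite -(as_char_pow2 ch2 (y ^+ q * x) (e * (2 * n).-1)) expnM -/q exprMn -exprM -expnS.
  by rewrite prednK ?muln_gt0 // -hF expf_card.
have -> : S * S = \sum_(x : F) \sum_(y : F) as_char (y ^+ q.+1) * as_char ((y + x) ^+ q.+1).
  rewrite exchange_big /S mulr_suml; apply: eq_bigr => y _.
  by rewrite mulr_sumr [LHS](reindex_inj (addrI y)).
have hr (x : F) : (x ^+ (q ^ (2 * n).-1) + x ^+ q == 0) = (x ^+ (q ^ 2) == x).
  rewrite -GRing.subr_pchar2 // subr_eq0 -(inj_eq frobq_inj) -!exprM -expnSr.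
  by rewrite prednK ?muln_gt0 // -hF expf_card mulnn eq_sym.
under eq_bigr => x _.
  rewrite (eq_bigr _ (fun y _ => hx x y)) -mulr_sumr sum_as_charM // hr.
  over.
rewrite (bigID (fun x : F => x ^+ (q ^ 2) == x)) /= [X in _ + X]big1 ?addr0; last first.
  by move=> x /negbTE ->; rewrite mulr0.
rewrite (eq_bigr (fun=> #|F|%:R)); last first.
  by move=> x /eqP hxx; rewrite hxx eqxx as_char_norm // mul1r.
rewrite sumr_const (_ : #|_| = (q ^ 2)%N); last first.
  by rewrite -[RHS]card_Fq2; apply: eq_card => x; rewrite !inE.
by rewrite hF -natrM -natrX -mulrnA expnMn -expnM mulnC [(n * 2)%N]mulnC.
Qed.

(* This fixes the sign, since q^(n+1) = 1 modulo q + 1. *)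
Lemma quadratic_sum_mod : exists T : int, S = 1 + q.+1%:R * T.
Proof.
have hd : (q.+1 * (#|F|.-1 %/ q.+1) = #|F|.-1)%N.
  rewrite mulnC divnK // hF -subn1 mul2n dvdn_even_pow // ltnW //.
(* y = 0 contributes 1, and each nonzero (q+1)-th power is attained q + 1 times. *)
exists (\sum_(a : F | (a != 0) && [exists x : F, x ^+ q.+1 == a]) as_char a).
rewrite /S (bigD1 0) //= expr0n /=; congr (_ + _).
  by have := mem_as_image (0 : F); rewrite /as_char expr0n addr0 => ->.
rewrite (partition_big (fun y : F => y ^+ q.+1)
  (fun a => (a != 0) && [exists x : F, x ^+ q.+1 == a])) /=; last first.
  by move=> y y0; rewrite expf_neq0 //=; apply/existsP; exists y.
rewrite mulr_sumr; apply: eq_bigr => a /andP[a0 /existsP[x /eqP hx]].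
rewrite (eq_bigr (fun=> as_char a)); last by move=> y /andP[_ /eqP ->].
have x0 : x != 0 by apply: contraNneq a0 => h; rewrite -hx h expr0n.
rewrite sumr_const (_ : #|_| = q.+1) ?mulr_natl //.
rewrite -[RHS](@card_pow_fiber F q.+1 (#|F|.-1 %/ q.+1) a hd); last first.
  by rewrite -hx -exprM hd expf_card_pred.
apply: eq_card => y; rewrite !inE unfold_in /=; case: (eqVneq y 0) => [->|] //=.
by rewrite expr0n [RHS]eq_sym (negbTE a0).
Qed.

Lemma quadratic_sum : S = q%:R * (q ^ n)%:R.
Proof.
have /eqP := quadratic_sum_sqr; rewrite -expr2 eqf_sqr => /orP[/eqP//|/eqP hS].
have [T hT] := quadratic_sum_mod.
have hd : (q.+1 %| q ^ n.+1 - 1)%N.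
  by have := dvdn_even_pow (n.+1)./2 (ltnW q1); rewrite even_halfK //= hn.
have [k hk] := dvdnP hd.
have hq : (q * q ^ n = k * q.+1 + 1)%N.
  by rewrite -hk -expnS subnK // expn_gt0 ltnW.
move: hS; rewrite hT -natrM hq natrD natrM => h.
have : (q.+1%:R * (T + k%:R) = - 2 :> int) by lia.
move=> h2; have : (q.+1 %| 2)%N.
  have : (q.+1%:Z %| 2%:Z)%Z by apply/dvdzP; exists (- (T + k%:R)); lia.
  by [].
by move=> /dvdn_leq -/(_ isT); rewrite ltnS leqNgt q1.
Qed.

Definition as_curve : {set F * F} := [set p | p.1 ^+ 2 + p.1 == p.2 ^+ q.+1].

(** Above each y there are 1 + [as_char (y ^+ q.+1)] values of t, namely 2 or 0. *)
Lemma card_as_curve : #|as_curve| = (q ^ (2 * n) + q * q ^ n)%N.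
Proof.
apply/eqP; rewrite -(eqr_nat int) natrD natrM -quadratic_sum -hF.
rewrite -sum1_card (partition_big (fun p : F * F => p.2) predT) //= natr_sum.
have hy (y : F) : (\sum_(p in as_curve | p.2 == y) 1)%N%:R = 1 + as_char (y ^+ q.+1) :> int.
  have -> : (\sum_(p in as_curve | p.2 == y) 1)%N = #|[set t : F | t ^+ 2 + t == y ^+ q.+1]|.
    rewrite -(card_imset _ (f := fun t : F => (t, y))); last by move=> t t' [].
    rewrite -sum1_card; apply: eq_bigl => -[t z]; rewrite !inE /=.
    apply/andP/imsetP => [[/eqP ht /eqP hz]|[t' ht [-> ->]]].
      by exists t; rewrite ?hz // inE -hz ht.
    by move: ht; rewrite inE => ->.
  by rewrite card_as_fiber // /as_char; case: ifP.
by rewrite (eq_bigr _ (fun y _ => hy y)) big_split /= sumr_const.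
Qed.

End QuadraticSum.

(** * Values of t at which f(t) is a nonzero m-th power *)

Section SplitFibers.

Variables (F : finFieldType) (e j m h : nat).
Let q := (2 ^ e)%N.
Let n := j.+1.*2.+1.
Let M := ((q ^ n + 1) %/ q.+1)%N.
Hypothesis e0 : (0 < e)%N.
Hypothesis hF : #|F| = (q ^ (2 * n))%N.
Hypothesis hm : (m * h = q ^ n + 1)%N.
Hypothesis hqm : (q.+1 %| m)%N.

Let ch2 : 2 \in [pchar F] := pchar2_card hF.
Let q1 : (1 < q)%N := q_gt1 e0.
Let hMq : (q.+1 * M = q ^ n + 1)%N := cofactor_mul j e0.

(** The exponent is (q^(2n) - 1) / (q + 1): t^2 + t is a nonzero (q+1)-th power. *)
Definition base_points : {set F} :=
  [set t | (t ^+ q != t) && ((t ^+ 2 + t) ^+ ((q ^ n - 1) * M) == 1)].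

(** The exponent is (q^(2n) - 1) / m: f(t) is a nonzero m-th power. *)
Definition split_points : {set F} :=
  [set t | (t ^+ q != t) && ((fiber_poly F q).[t] ^+ (h * (q ^ n - 1)) == 1)].

Lemma card_base_gt1 : (1 < q ^ n)%N.
Proof. by rewrite -{1}[1%N](expn0 q) ltn_exp2l. Qed.

Lemma card_units : (#|F|.-1 = (q ^ n + 1) * (q ^ n - 1))%N.
Proof. by rewrite mulnC -subn_sqr -expnM [(n * 2)%N]mulnC -hF subn1. Qed.

Lemma pow_units_cofactor (x : F) : x != 0 -> x ^+ (q.+1 * ((q ^ n - 1) * M)) = 1.
Proof.
by move=> x0; rewrite mulnCA hMq mulnC -card_units expf_card_pred.
Qed.

Lemma fq_sum_neq0 (t : F) : t ^+ q != t -> t ^+ q + t != 0.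
Proof. by rewrite addr_eq0 oppr_pchar2. Qed.

Lemma as_neq0 (t : F) : t ^+ q != t -> t ^+ 2 + t != 0.
Proof.
move=> ht; have := fq_sum_neq0 ht.
by rewrite -(ratio_poly_horner ch2 (ltnW q1)) mulf_eq0 => /norP[].
Qed.

Lemma base_points_fiber (t : F) : t \in base_points ->
  (fiber_poly F q).[t] ^+ ((q ^ n - 1) * M) = 1.
Proof.
rewrite inE => /andP[ht /eqP hY].
have := congr1 (fun x => x ^+ ((q ^ n - 1) * M)) (fiber_poly_frac ch2 (ltnW q1) t).
by rewrite exprMn exprAC hY expr1n mulr1 -exprM pow_units_cofactor // fq_sum_neq0.
Qed.

(** The curve t^2 + t = y^(q+1) is projected to t. Base points and the q - 2 elements of F_q other
    than 0 and 1 carry at most q + 1 points each, while 0 and 1 carry one each. *)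
Lemma card_base_points :
  (q ^ n * q ^ n + q * q ^ n + q <= q.+1 * #|base_points| + q ^ 2)%N.
Proof.
have hn : odd n by rewrite /n /= odd_double.
have hc := card_as_curve e0 (ltn0Sn _) hn ch2 hF.
rewrite -sum1_card (partition_big (fun p : F * F => p.1) predT) //= in hc.
have hfib (t : F) : (\sum_(p in as_curve F e | p.1 == t) 1 =
    #|[set y : F | (y ^+ q.+1 == t ^+ 2 + t)%R]|)%N.
  rewrite -(card_imset _ (f := fun y : F => (t, y))); last by move=> y y' [].
  rewrite -sum1_card; apply: eq_bigl => -[s z]; rewrite !inE /=.
  apply/andP/imsetP => [[/eqP hs /eqP hz]|[z' hz [-> ->]]].
    by exists z; rewrite ?hz // inE -hz hs.
  by move: hz; rewrite inE eq_sym => ->.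
rewrite (eq_bigr _ (fun t _ => hfib t)) in hc.
pose K := [set x : F | x ^+ q == x] :\ 0 :\ 1.
have hK : (#|K| + 2 = q)%N.
  have hq := card_Fq e0 hF.
  rewrite (cardsD1 0) (cardsD1 1) !inE expr0n expr1n (gtn_eqF (ltnW q1)) eqxx oner_eq0 /= in hq.
  by rewrite -[RHS]hq eqxx addnC.
pose Z01 : {set F} := [set 0; 1].
have hbound (t : F) : (#|[set y : F | (y ^+ q.+1 == t ^+ 2 + t)%R]| <=
   q.+1 * (t \in base_points) + (q.+1 * (t \in K) + (t \in Z01)))%N.
  have hle := card_pow_fiber_le (t ^+ 2 + t) (ltn0Sn q).
  case: (boolP (t \in Z01)) => ht01.
    have h0 : t ^+ 2 + t = 0.
      move: ht01; rewrite !inE => /orP[]/eqP->; first by rewrite expr0n addr0.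
      by rewrite expr1n addrr_pchar2.
    rewrite h0 (_ : [set y | y ^+ q.+1 == 0] = [set 0]) ?cards1; first by lia.
    by apply/setP => y; rewrite !inE expf_eq0.
  case: (boolP (t ^+ q == t)) => htq.
    have -> : t \in K by move: ht01; rewrite !inE htq andbT negb_or andbC.
    by rewrite muln1 addn0; apply: leq_trans hle _; rewrite leq_addl.
  case: (set_0Vmem [set y : F | y ^+ q.+1 == t ^+ 2 + t]) => [->|[y]].
    by rewrite cards0.
  rewrite inE => /eqP hy; have -> : t \in base_points.
    rewrite inE htq -hy -exprM pow_units_cofactor ?eqxx //.
    by apply: contraNneq (as_neq0 htq) => y0; rewrite -hy y0 expr0n.
  by rewrite muln1; apply: leq_trans hle _; rewrite leq_addr.
have hsum (A : {set F}) : (\sum_t (t \in A) = #|A|)%N.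
  by rewrite -sum1_card [RHS]big_mkcond; apply: eq_bigr => t _; case: ifP.
have : (q ^ (2 * n) + q * q ^ n <= q.+1 * #|base_points| + (q.+1 * #|K| + 2))%N.
  rewrite -hc; apply: leq_trans (leq_sum _ (fun t _ => hbound t)) _.
  rewrite !big_split /= -!big_distrr /= !hsum cards2.
  by rewrite !leq_add // ; case: (_ != _).
rewrite mul2n -addnn expnD -mulnn; move: hK; clear; nia.
Qed.

(** Base points are sorted by c = f(t)^(q^n - 1), which satisfies c^M = 1. The M - h values with c^h
    different from 1 are in particular not 1, so [card_twisted_fiber] bounds their share; the rest
    are split points. *)
Lemma card_split_points :
  ((q ^ n - (q ^ 2 - q)) * h + q * q ^ n - q ^ n <= #|split_points|)%N.
Proof.
have [r hr] := dvdnP hqm.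
have hMr : (M = r * h)%N.
  by apply/eqP; rewrite -(@eqn_pmul2l q.+1) // hMq -hm hr; apply/eqP; ring.
have hhF : (h %| #|F|.-1)%N by rewrite card_units -hm -mulnA dvdn_mull // dvdn_mulr.
have hMF : (M %| #|F|.-1)%N by rewrite card_units -hMq dvdn_mulr // dvdn_mull.
pose C := [set c : F | c ^+ M == 1] :\: [set c : F | c ^+ h == 1].
have hC : (#|C| = M - h)%N.
  rewrite cardsD (setIidPr _) ?card_unity_root //.
  by apply/subsetP => c; rewrite !inE hMr mulnC exprM => /eqP ->; rewrite expr1n.
have hsub : base_points \subset split_points :|: \bigcup_(c in C) twisted_fiber e j c.
  apply/subsetP => t ht; have hf := base_points_fiber ht.
  have /andP[htq /eqP hY] : (t ^+ q != t) && ((t ^+ 2 + t) ^+ ((q ^ n - 1) * M) == 1).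
    by move: ht; rewrite inE.
  rewrite !inE htq /=; case: (boolP (_ == 1)) => //= hh.
  set c := (fiber_poly F q).[t] ^+ (q ^ n - 1).
  have hQ (x : F) : x ^+ (q ^ n) = x ^+ (q ^ n - 1) * x.
    by rewrite -exprSr -addn1 subnK // ltnW // card_base_gt1.
  apply/bigcupP; exists c.
    by rewrite !inE -!exprM hf eqxx andbT [(_ * h)%N]mulnC.
  by rewrite inE htq /= !hQ -exprM mulnC hY mul1r !eqxx.
have hcard : (#|base_points| <= #|split_points| + (M - h) * (q ^ n - (q ^ 2 - q)))%N.
  apply: leq_trans (subset_leq_card hsub) _; apply: leq_trans (leq_card_setU _ _) _.
  rewrite leq_add2l -hC -sum_nat_const.
  elim/big_rec2: _ => [|c x A hc hA]; first by rewrite cards0.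
  apply: leq_trans (leq_card_setU _ _) _; apply: leq_add => //.
  apply: card_twisted_fiber => //; apply: contraTneq hc => ->.
  by rewrite !inE !expr1n eqxx.
have hb := card_base_points; have hqM := hMq.
have hhM : (h <= M)%N.
  rewrite hMr leq_pmull // lt0n; apply/eqP => r0.
  by move: hm; rewrite hr r0 mul0n addn1.
have hQq : (q ^ 2 <= q ^ n)%N by rewrite leq_exp2l.
have hqq : (q <= q ^ 2)%N by rewrite -{1}[q]expn1 leq_exp2l.
(* With Q = q^n and D = Q - (q^2 - q), everything is multiplied by q + 1. Since (q + 1) M = Q + 1,
   the conclusion rests on Q^2 + qQ + q - q^2 - (Q + 1) D = (q^2 - 1) Q. *)
move: (#|base_points|) (#|split_points|) (q ^ n)%N M h hcard hb hqM hhM hQq hqq.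
move: q1; clear; case: q => // p _ T G Q N k hT hb hN hk hQ _.
have [D hD] : exists D, Q = (D + p * p.+1)%N.
  by exists (Q - p * p.+1)%N; rewrite subnK // (leq_trans _ hQ) // -mulnn leq_mul2r leqnSn orbT.
have [d hd] : exists d, N = (k + d)%N by exists (N - k)%N; rewrite subnKC.
have hpD : (Q - (p.+1 ^ 2 - p.+1) = D)%N by rewrite hD -mulnn mulSn addKn mulnC addnK.
rewrite hpD in hT *; rewrite -mulnn in hb; rewrite leq_subLR -(leq_pmul2l (ltn0Sn p.+1)).
have hT' : (p.+2 * T <= p.+2 * (G + d * D))%N.
  by rewrite leq_pmul2l // (leq_trans hT) // hd addKn.
have hND := congr1 (muln D) hN; rewrite hd in hND.
move: hT' hb hND; rewrite hD; clear; lia.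
Qed.

End SplitFibers.

(** * The norm bound on the number of zeros *)

Section TopCoefficients.

Variable R : comNzRingType.

Lemma coefM_top (p r : {poly R}) (a b : nat) :
  (size p <= a.+1)%N -> (size r <= b.+1)%N -> (p * r)`_(a + b) = p`_a * r`_b.
Proof.
move=> hp hr; rewrite coefM.
have ha : (a < (a + b).+1)%N by rewrite ltnS leq_addr.
rewrite (bigD1 (Ordinal ha)) //= addKn big1 ?addr0 // => i hi.
have {hi} : (i != a :> nat) by [].
rewrite neq_ltn => /orP[hi|hi].
  by rewrite [r`__]nth_default ?mulr0 // (leq_trans hr) // ltn_subRL; lia.
by rewrite nth_default ?mul0r // (leq_trans hp).
Qed.

Lemma coef_prod_top (I : finType) (p : I -> {poly R}) (d : I -> nat) :
  (forall i, size (p i) <= (d i).+1)%N ->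
  (size (\prod_i p i)%R <= (\sum_i d i).+1)%N /\
  (\prod_i p i)`_(\sum_i d i)%N = \prod_i (p i)`_(d i).
Proof.
move=> hp; elim/big_rec3: _ => [|i y1 y2 y3 _ [h1 h2]].
  by rewrite size_poly1 coef1.
split; last by rewrite coefM_top // h2.
by apply: leq_trans (size_polyMleq _ _) _; have := hp i; lia.
Qed.

(** Each Leibniz term takes one entry from every column, so the column bounds add up and the top
    coefficients form a Leibniz sum again. *)
Lemma det_top (n : nat) (A : 'M[{poly R}]_n) (d : 'I_n -> nat) :
  (forall i j, size (A i j) <= (d j).+1)%N ->
  (size (\det A) <= (\sum_j d j).+1)%N /\
  (\det A)`_(\sum_j d j)%N = \det (\matrix_(i, j) (A i j)`_(d j)).
Proof.
move=> hA.
have hs (s : 'S_n) : (\sum_j d j = \sum_i d (s i))%N.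
  by rewrite (reindex_inj (@perm_inj _ s)).
have hterm (s : 'S_n) := coef_prod_top (fun i => hA i (s i)).
split.
  apply: (big_ind (fun p : {poly R} => size p <= (\sum_j d j).+1)%N).
  - by rewrite size_poly0.
  - by move=> x y hx hy; apply: leq_trans (size_polyD _ _) _; rewrite geq_max hx.
  move=> s _; rewrite -signr_odd; case: (odd _); rewrite ?expr1 ?expr0 ?mulN1r ?mul1r ?size_polyN (hs s);
    by case: (hterm s).
rewrite coef_sum; apply: eq_bigr => s _.
have -> : (-1) ^+ s = ((-1) ^+ s)%:P :> {poly R} by rewrite rmorphXn rmorphN rmorph1.
rewrite coefCM (hs s); case: (hterm s) => _ ->; congr (_ * _).
by apply: eq_bigr => i _; rewrite mxE.
Qed.

End TopCoefficients.

Section Corank.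

Variable F : fieldType.

(** A constant invertible change of rows makes the first k rows vanish at b, and each of them then
    yields a factor X - b. *)
Lemma det_corank (m k : nat) (A : 'M[{poly F}]_m) (K : 'M[F]_(k, m)) (b : F) :
  row_free K -> K *m map_mx (horner_eval b) A = 0 -> ('X - b%:P) ^+ k %| \det A.
Proof.
move=> hK hKA; set E := row_ebase K.
have hr : \rank K = k by apply/eqP.
have km : (k <= m)%N by rewrite -hr rank_leq_col.
have hE : E \in unitmx by apply: row_ebase_unit.
pose B := map_mx polyC E *m A.
have hEB : (pid_mx k : 'M_(k, m)) *m E *m map_mx (horner_eval b) A = 0.
  have := mulmx_ebase K; rewrite hr => h.
  have -> : (pid_mx k : 'M_(k, m)) *m E = invmx (col_ebase K) *m K.
    by apply: (canRL (mulKmx (col_ebase_unit K))); rewrite mulmxA h.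
  by rewrite -mulmxA hKA mulmx0.
have hBb (i j : 'I_m) : (i < k)%N -> (B i j).[b] = 0.
  move=> ik; have := congr1 (fun M : 'M_(k, m) => M (Ordinal ik) j) hEB.
  rewrite -mulmxA [LHS]mxE (bigD1 i) //= [X in _ + X]big1 ?addr0; last first.
    by move=> l li; rewrite mxE /= eq_sym (_ : (l == i :> nat) = false) ?mul0r //; apply: negbTE.
  rewrite !mxE /= eqxx ik mul1r => h0; rewrite -[RHS]h0 horner_sum.
  by apply: eq_bigr => l _; rewrite !mxE hornerM hornerC.
pose u (i : nat) : nat := (i < k)%N.
pose B' := \matrix_(i < m, j < m) (B i j %/ ('X - b%:P) ^+ u i).
have hB : B = diag_mx (\row_i ('X - b%:P) ^+ u i) *m B'.
  apply/matrixP => i j; rewrite mul_diag_mx !mxE mulrC divpK //.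
  rewrite /u; case: (boolP (i < k)%N) => ik; last by rewrite expr0 dvd1p.
  by rewrite expr1 dvdp_XsubCl; apply/rootP; have := hBb i j ik; rewrite !mxE.
have hdet : (\det E)%:P * \det A = ('X - b%:P) ^+ k * \det B'.
  rewrite -det_map_mx -det_mulmx -/B hB det_mulmx det_diag; congr (_ * _).
  rewrite (eq_bigr (fun i : 'I_m => ('X - b%:P) ^+ u i)); last by move=> i _; rewrite mxE.
  rewrite prodrXr; congr (_ ^+ _).
  rewrite -(big_mkord xpredT u) (big_cat_nat (n := k)) //=.
  rewrite (eq_big_nat _ _ (F2 := fun=> 1%N)) => [|i /andP[_ ik]]; last by rewrite /u ik.
  rewrite [X in (_ + X)%N](eq_big_nat _ _ (F2 := fun=> 0%N)) => [|i /andP[ik _]]; last first.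
    by rewrite /u ltnNge ik.
  by rewrite !big_const_nat !iter_addn mul0n mul1n subn0 !addn0.
have dE : \det E != 0 by move: hE; rewrite unitmxE unitfE.
rewrite -(dvdpZr _ _ dE) -mul_polyC hdet dvdp_mulr //.
Qed.

Lemma dvdp_prod_XsubC (s : seq F) (k : F -> nat) (p : {poly F}) :
  uniq s -> (forall b, b \in s -> ('X - b%:P) ^+ k b %| p) ->
  \prod_(b <- s) ('X - b%:P) ^+ k b %| p.
Proof.
elim: s => [|b s IH] /=; first by rewrite big_nil dvd1p.
move=> /andP[bs us] h; rewrite big_cons Gauss_dvdp.
  by rewrite h ?mem_head //= IH // => c cs; apply: h; rewrite in_cons cs orbT.
rewrite coprimep_expl // coprimep_sym coprimep_XsubC rootE horner_prod prodf_seq_eq0.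
apply/hasPn => c cs /=; rewrite horner_exp !hornerE expf_eq0 subr_eq0 negb_and.
by apply/orP; right; apply: contraNneq bs => ->.
Qed.

(* Dedekind's independence of characters, twisted by a cocycle. *)
Lemma multiplicative_independent (I : finZmodType) (Z : finType) (chi : Z -> I -> F) (gam : I -> I -> F) :
  (forall P i k, chi P i * chi P k = gam i k * chi P (i + k)) ->
  (forall P, chi P 0 = 1) -> (forall P P', chi P =1 chi P' -> P = P') ->
  forall a : Z -> F, (forall i, \sum_P a P * chi P i = 0) -> forall P, a P = 0.
Proof.
move=> hmul h1 hinj a; move: {2}#|[set P | a P != 0]| (leqnn #|[set P | a P != 0]|) => N.
elim: N a => [|N IH] a hN ha P0.
  apply/eqP; apply: contraTT hN => aP; rewrite -ltnNge card_gt0.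
  by apply/set0Pn; exists P0; rewrite inE.
apply/eqP; apply: contraT => aP0.
have [P1 aP1 P10] : exists2 P1, a P1 != 0 & P1 != P0.
  have := ha 0; rewrite (bigD1 P0) //= h1 mulr1.
  case: (pickP (fun P1 => (a P1 != 0) && (P1 != P0))) => [P1 /andP[]|hno]; first by exists P1.
  rewrite big1 ?addr0 => [h|P1 hP1]; first by rewrite h eqxx in aP0.
  by move: (hno P1); rewrite hP1 andbT => /negbFE/eqP->; rewrite mul0r.
have [k hk] : exists k, chi P1 k != chi P0 k.
  apply/existsP; apply: contraT; rewrite negb_exists => /forallP h.
  by case/eqP: P10; apply: hinj => i; apply/eqP; rewrite -[_ == _]negbK.
(* Multiplying the relation by the value at k and subtracting [chi P0 k] times it removes [P0] from
   the support but keeps [P1]. *)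
pose a' P := a P * (chi P k - chi P0 k).
have := IH a' _ _ P1; rewrite /a' => h.
have /eqP : a P1 * (chi P1 k - chi P0 k) = 0.
  apply: h => [|i]; last first.
    transitivity (gam k i * (\sum_P a P * chi P (k + i)) - chi P0 k * (\sum_P a P * chi P i)).
      rewrite !mulr_sumr -sumrB; apply: eq_bigr => P _.
      by rewrite mulrBr mulrBl -mulrA hmul; ring.
    by rewrite !ha !mulr0 subr0.
  rewrite -ltnS; apply: leq_trans hN; apply: proper_card.
  apply/properP; split; last by exists P0; rewrite !inE ?aP0 // subrr mulr0 eqxx.
  by apply/subsetP => P; rewrite !inE mulf_eq0 negb_or => /andP[].
by rewrite mulf_eq0 (negbTE aP1) subr_eq0 (negbTE hk).
Qed.

End Corank.

Section NormBound.

Variables (F : finFieldType) (m' : nat).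
Let m := m'.+1.
Local Notation I := 'I_m'.+1.
Variables (W : I -> nat) (c : I -> I -> {poly F}).
Hypothesis hc : forall i k, c i k \is monic.
Hypothesis hW : forall i k, (m * (size (c i k)).-1 + W (i + k)%R = W i + W k)%N.
Hypothesis Winj : forall i k, (W i = W k %[mod m])%N -> i = k.

Variables (g : I -> {poly F}) (w : nat) (i0 : I).
Hypothesis hg : forall i, g i != 0 -> (m * (size (g i)).-1 + W i <= w)%N.
Hypothesis gi0 : g i0 != 0.
Hypothesis hi0 : (m * (size (g i0)).-1 + W i0 = w)%N.

(* [A] is the matrix of multiplication by sum_i g_i b_i on a free F[t]-module with basis b and
   b_i b_k = c_ik b_(i+k). Substituting t = s^m and scaling the rows turns the weights
   m deg g_i + W_i into degrees in s; since the W_i are distinct modulo m, the leading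
   coefficients then form a monomial matrix. *)
Let A : 'M[{poly F}]_m := \matrix_(a, b) (g (a - b) * c (a - b) b).
Let A' : 'M[{poly F}]_m := \matrix_(a, b) ('X^(W a) * (A a b \Po 'X^m)).

Lemma size_comp_Xm (p : {poly F}) : p != 0 -> size (p \Po 'X^m) = (m * (size p).-1).+1.
Proof.
move=> p0; have := size_comp_poly p 'X^m; rewrite size_polyXn /= => h.
by rewrite mulnC -h prednK // lt0n size_poly_eq0 comp_poly_eq0 // size_polyXn.
Qed.

Lemma size_norm_entry (a b : I) : g (a - b) != 0 ->
  size (A' a b) = (m * (size (g (a - b))).-1 + W (a - b)%R + W b).+1.
Proof.
move=> g0; rewrite !mxE.
have c0 : c (a - b) b != 0 by apply: monic_neq0.
have gc0 : g (a - b) * c (a - b) b != 0 by rewrite mulf_neq0.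
rewrite mulrC size_mulXn ?comp_poly_eq0 ?size_polyXn // size_comp_Xm // size_mul //.
have := hW (a - b) b; rewrite subrK.
have : (0 < size (g (a - b)%R))%N by rewrite size_poly_gt0.
have : (0 < size (c (a - b)%R b))%N by rewrite size_poly_gt0.
case: (size (c _ _)) => // s _; case: (size (g _)) => // s' _ /=.
move=> h; have -> : (s'.+1 + s.+1).-1.-1 = (s' + s)%N by rewrite addSn addnS.
by rewrite addnS mulnDr -[in RHS]addnA -h addnC addnA.
Qed.

Lemma norm_entry_top (a b : I) : a - b = i0 -> (A' a b)`_(w + W b) != 0.
Proof.
move=> hab; have g0 : g (a - b) != 0 by rewrite hab.
have := size_norm_entry g0; rewrite hab hi0 => hs.
have -> : (A' a b)`_(w + W b) = lead_coef (A' a b) by rewrite lead_coefE hs.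
by rewrite lead_coef_eq0 -size_poly_eq0 hs.
Qed.

Lemma size_norm_entry_le (a b : I) : (size (A' a b) <= (w + W b).+1)%N.
Proof.
case: (eqVneq (g (a - b)) 0) => [g0|g0]; last first.
  by rewrite size_norm_entry // ltnS leq_add2r hg.
by rewrite !mxE g0 mul0r comp_poly0 mulr0 size_poly0.
Qed.

Lemma norm_entry_low (a b : I) : a - b != i0 -> (A' a b)`_(w + W b) = 0.
Proof.
move=> hab; case: (eqVneq (g (a - b)) 0) => [g0|g0].
  by rewrite !mxE g0 mul0r comp_poly0 mulr0 coef0.
rewrite nth_default // size_norm_entry // addnC [(w + _)%N]addnC ltn_add2l ltn_neqAle hg // andbT.
apply: contraNneq hab => h; apply/eqP/Winj.
rewrite -hi0 ![(m * _)%N]mulnC in h.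
by have := congr1 (modn^~ m) h; rewrite /= !modnMDl.
Qed.

(** The top coefficient at (a, b) is nonzero exactly when a - b = [i0], so their determinant is
    nonzero. The row scaling adds the sum of the W to the degree in s, which cancels against the
    column bounds and leaves m deg <= m w. *)
Lemma det_norm : \det A != 0 /\ (size (\det A) <= w.+1)%N.
Proof.
have [h1 h2] := det_top size_norm_entry_le.
have hL : \det (\matrix_(i, j) (A' i j)`_(w + W j)) != 0.
  apply/det0P => -[v v0 hv]; case/eqP: v0; apply/rowP => a; rewrite [RHS]mxE.
  have := congr1 (fun M : 'rV_m => M 0 (a - i0)) hv; rewrite !mxE (bigD1 a) //= big1 ?addr0.
    move/eqP; rewrite mulf_eq0 mxE => /orP[/eqP//|].
    by rewrite (negbTE (norm_entry_top _)) // subKr.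
  move=> b ba; rewrite mxE norm_entry_low ?mulr0 //; apply: contraNneq ba => h.
  by rewrite -[b](subrK (a - i0)) h addrC subrK.
have hA' : \det A' = 'X^(\sum_a W a) * (\det A \Po 'X^m).
  have -> : A' = diag_mx (\row_a 'X^(W a)) *m map_mx (comp_poly 'X^m) A.
    by apply/matrixP => a b; rewrite mul_diag_mx !mxE.
  rewrite det_mulmx det_diag det_map_mx; congr (_ * _).
  rewrite (eq_bigr (fun a => 'X^(W a))); last by move=> a _; rewrite mxE.
  by rewrite prodrXr.
have A0 : \det A != 0.
  apply: contraNneq hL => h0; rewrite -h2 hA' h0 comp_poly0 mulr0 coef0 //.
split=> //; move: h1; rewrite hA' mulrC size_mulXn ?comp_poly_eq0 ?size_polyXn //.
rewrite size_comp_Xm // big_split /= sum_nat_const card_ord addnS ltnS addnC leq_add2r.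
by rewrite leq_pmul2l //; case: (size _) => [|s].
Qed.

Variables (Pt : finType) (tP : Pt -> F) (chi : Pt -> I -> F).
Hypothesis chiM : forall P i k, chi P i * chi P k = (c i k).[tP P] * chi P (i + k).
Hypothesis chi1 : forall P, chi P 0 = 1.
Hypothesis chi_inj : forall P P', tP P = tP P' -> chi P =1 chi P' -> P = P'.

Definition zero_set : {set Pt} := [set P | \sum_i (g i).[tP P] * chi P i == 0].

(** For a zero P above b, the vector [chi P] lies in the left kernel of A at t = b. These vectors
    are independent, so the number of zeros above b is at most the multiplicity of b in det A. *)
Lemma card_zeros_le : (#|zero_set| <= w)%N.
Proof.
have [A0 hA] := det_norm.
pose Zb b := [set P in zero_set | tP P == b].
have hdiv b : ('X - b%:P) ^+ #|Zb b| %| \det A.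
  pose K : 'M[F]_(#|Zb b|, m) := \matrix_(i, j) chi (enum_val i) j.
  have hP (i : 'I_#|Zb b|) : enum_val i \in zero_set /\ tP (enum_val i) = b.
    by have := enum_valP i; rewrite inE => /andP[-> /eqP].
  apply: (@det_corank F m #|Zb b| A K b).
    rewrite -kermx_eq0; apply/eqP/row_matrixP => r; rewrite row0.
    apply/rowP => i; rewrite [RHS]mxE.
    set v := row r (kermx K).
    have hv : v *m K = 0 by apply/sub_kermxP; rewrite row_sub.
    apply: (@multiplicative_independent F _ _ (fun i : 'I_#|Zb b| => chi (enum_val i)) (fun i k => (c i k).[b]) _ _ _ (fun i => v 0 i)).
    - by move=> P k l; rewrite chiM (hP P).2.
    - by move=> P; rewrite chi1.
    - move=> P P' h; apply: enum_val_inj; apply: chi_inj h.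
      by rewrite (hP P).2 (hP P').2.
    - move=> k; transitivity ((v *m K) 0 k); last by rewrite hv mxE.
      by rewrite [RHS]mxE; apply: eq_bigr => l _; rewrite [K l k]mxE.
  apply/matrixP => i k; rewrite [RHS]mxE [LHS]mxE.
  have [hz ht] := hP i; set P := enum_val i in hz ht.
  transitivity (\sum_a ((g a).[b] * chi P a) * chi P k).
    rewrite (reindex_inj (addIr k)) /=; apply: eq_bigr => a _.
    by rewrite !mxE addrK /horner_eval hornerM -/P -[in RHS]mulrA chiM ht; ring.
  by rewrite -mulr_suml -ht; move: hz; rewrite inE => /eqP ->; rewrite mul0r.
have hprod : \prod_(b <- enum F) ('X - b%:P) ^+ #|Zb b| %| \det A.
  by apply: dvdp_prod_XsubC => [|b _]; [exact: enum_uniq | exact: hdiv].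
have := leq_trans (dvdp_leq A0 hprod) hA.
rewrite big_enum /= size_prod => [|b _]; last by rewrite expf_neq0 // polyXsubC_eq0.
rewrite (eq_bigr (fun b => #|Zb b| + 1)%N); last by move=> b _; rewrite size_exp_XsubC addn1.
rewrite big_split /= sum_nat_const muln1 -addSn addnK ltnS.
rewrite -sum1_card (partition_big tP predT) //=.
congr (_ <= _)%N; apply: eq_bigr => b _.
by rewrite -sum1_card; apply: eq_bigl => P; rewrite [in LHS]inE.
Qed.

End NormBound.

(** * The code *)

Section EvaluationCode.

Variables (F : finFieldType) (m' : nat).
Let m := m'.+1.
Local Notation I := 'I_m'.+1.
Variables (W : I -> nat) (c : I -> I -> {poly F}).
Hypothesis hc : forall i k, c i k \is monic.
Hypothesis hW : forall i k, (m * (size (c i k)).-1 + W (i + k)%R = W i + W k)%N.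
Hypothesis Winj : forall i k, (W i = W k %[mod m])%N -> i = k.
Hypothesis W0 : W 0 = 0%N.

Variables (N : nat) (tP : 'I_N -> F) (chi : 'I_N -> I -> F).
Hypothesis chiM : forall P i k, chi P i * chi P k = (c i k).[tP P] * chi P (i + k).
Hypothesis chi1 : forall P, chi P 0 = 1.
Hypothesis chi_inj : forall P P', tP P = tP P' -> chi P =1 chi P' -> P = P'.

Variables (k : nat) (B : {set F}).
Hypothesis hkN : (k * m < N)%N.
Hypothesis hBk : #|B| = k.
Hypothesis hB : forall b, b \in B -> #|[set P | tP P == b]| = m.

(** A weight of at most k m forces the exponent of t to be at most k, so the type ['I_k.+1] loses no
    monomial. *)
Definition low_monomials : {set I * 'I_k.+1} := [set p : I * 'I_k.+1 | (W p.1 + m * p.2 <= k * m)%N].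

Let K := #|low_monomials|.
Let mono (i : 'I_K) : I * 'I_k.+1 := enum_val i.

Definition gen_mx : 'M[F]_(K, N) := \matrix_(i, P) (tP P ^+ (mono i).2 * chi P (mono i).1).

Definition coord_poly (x : 'rV[F]_K) (j : I) : {poly F} :=
  \sum_(i | (mono i).1 == j) x 0 i *: 'X^((mono i).2).

Lemma coef_coord_poly (x : 'rV[F]_K) (j : I) (d : nat) :
  (coord_poly x j)`_d = \sum_(i | ((mono i).1 == j) && ((mono i).2 == d :> nat)) x 0 i.
Proof.
rewrite coef_sum [RHS]big_mkcondr; apply: eq_bigr => i _.
by rewrite coefZ coefXn eq_sym; case: eqP; rewrite ?mulr1 ?mulr0.
Qed.

Lemma gen_mxE (x : 'rV[F]_K) (P : 'I_N) :
  (x *m gen_mx) 0 P = \sum_j (coord_poly x j).[tP P] * chi P j.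
Proof.
rewrite mxE (partition_big (fun i => (mono i).1) predT) //=.
apply: eq_bigr => j _; rewrite horner_sum mulr_suml; apply: eq_bigr => i /eqP <-.
by rewrite mxE hornerZ hornerXn mulrA.
Qed.

Lemma coord_poly_weight (x : 'rV[F]_K) (j : I) :
  coord_poly x j != 0 -> (m * (size (coord_poly x j)).-1 + W j <= k * m)%N.
Proof.
rewrite -lead_coef_eq0 lead_coefE coef_coord_poly => h.
have [i /andP[/eqP hj /eqP hd]] : exists i, ((mono i).1 == j) && ((mono i).2 == (size (coord_poly x j)).-1 :> nat).
  apply/existsP; apply: contraNT h; rewrite negb_exists => /forallP h.
  by rewrite big_pred0 // => i; apply/negbTE.
by have := enum_valP i; rewrite inE -/(mono i) hj hd addnC.
Qed.

Lemma coord_poly_neq0 (x : 'rV[F]_K) : x != 0 -> exists j, coord_poly x j != 0.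
Proof.
move=> x0; have [i hi] : exists i, x 0 i != 0.
  apply/existsP; apply: contraNT x0; rewrite negb_exists => /forallP h.
  by apply/eqP/rowP => i; rewrite mxE; apply/eqP; have := h i; rewrite negbK.
exists (mono i).1; apply: contraNneq hi => h.
have := coef_coord_poly x (mono i).1 (mono i).2; rewrite h coef0 (bigD1 i) ?eqxx //=.
rewrite big1 ?addr0 => [->//|l /andP[/andP[/eqP h1 /eqP h2] li]].
case/eqP: li; apply: enum_val_inj; rewrite -/(mono l) -/(mono i).
by case: (mono l) (mono i) h1 h2 => [a b] [a' b'] /= -> /val_inj ->.
Qed.

Lemma card_zeros_gen (x : 'rV[F]_K) : x != 0 ->
  (#|[set P | (x *m gen_mx)%R 0%R P == 0%R]| <= k * m)%N.
Proof.
move=> x0; have [j0 hj0] := coord_poly_neq0 x0.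
have [i0 hi0 hmax] := @arg_maxnP _ j0 (fun j => coord_poly x j != 0)
  (fun j => (m * (size (coord_poly x j)).-1 + W j)%N) hj0.
have := @card_zeros_le F m' W c hc hW Winj (coord_poly x) _ i0 hmax hi0 erefl _ tP chi chiM chi1 chi_inj.
move=> h; apply: leq_trans (coord_poly_weight hi0); apply: leq_trans h.
by apply: subset_leq_card; apply/subsetP => P; rewrite !inE gen_mxE.
Qed.

Lemma card_zerosC (x : 'rV[F]_K) :
  #|[set P | (x *m gen_mx) 0 P != 0]| = (N - #|[set P | (x *m gen_mx)%R 0%R P == 0%R]|)%N.
Proof.
by rewrite [LHS]cardsCs card_ord; congr (_ - _)%N; apply: eq_card => P; rewrite !inE negbK.
Qed.

Let code : {vspace 'rV[F]_N} := limg (linfun (mulmxr gen_mx)).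

(** A nonzero function has at most k m < N zeros, so evaluation is injective and distances are at
    least N - k m. The product of t - b over B vanishes at exactly m points above each b and attains
    this. *)
Lemma evaluation_code : is_linear_code #|low_monomials| (N - k * m) code.
Proof.
have inj (x : 'rV[F]_K) : x *m gen_mx = 0 -> x = 0.
  move=> h; apply/eqP; apply: contraTT hkN => x0; rewrite -leqNgt.
  have := card_zeros_gen x0; rewrite (_ : [set P | _] = setT) ?cardsT ?card_ord //.
  by apply/setP => P; rewrite !inE h mxE eqxx.
have codeP u : reflect (exists x : 'rV[F]_K, u = x *m gen_mx) (u \in code).
  apply: (iffP memv_imgP) => [[x _ ->]|[x ->]].
    by exists x; rewrite lfunE.
  by exists x; rewrite ?memvf // lfunE.
have hd (x y : 'rV[F]_K) : hamming_dist (x *m gen_mx) (y *m gen_mx) =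
    (N - #|[set P | ((x - y) *m gen_mx)%R 0%R P == 0%R]|)%N.
  rewrite -card_zerosC; apply: eq_card => P; rewrite !inE -subr_eq0; congr (~~ (_ == 0)).
  by rewrite mulmxBl !mxE.
split.
  rewrite limg_dim_eq ?dimvf /dim /= ?mul1n //.
  apply/eqP; rewrite -subv0; apply/subvP => x; rewrite memv_cap memv_ker lfunE /=.
  by move=> /andP[_ /eqP /inj ->]; rewrite mem0v.
split; last first.
  move=> u v /codeP[x ->] /codeP[y ->] uv; rewrite hd.
  apply: leq_sub2l; apply: card_zeros_gen; rewrite subr_eq0.
  by apply: contraNneq uv => ->.
pose p : {poly F} := \prod_(b <- enum B) ('X - b%:P).
pose x : 'rV[F]_K := \row_i (if (mono i).1 == 0 then p`_((mono i).2) else 0).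
have sp : size p = k.+1 by rewrite /p size_prod_XsubC -cardE hBk.
have hx j : coord_poly x j = if j == 0 then p else 0.
  apply/polyP => d; rewrite coef_coord_poly; case: eqVneq => [->|j0]; last first.
    by rewrite coef0 big1 // => i /andP[/eqP hi _]; rewrite mxE hi (negbTE j0).
  case: (ltnP d k.+1) => dk; last first.
    rewrite [RHS]nth_default ?sp // big1 // => i /andP[_ /eqP hi].
    by move: (ltn_ord (mono i).2); rewrite hi ltnNge dk.
  have hmem : (0, Ordinal dk) \in low_monomials.
    by rewrite inE W0 add0n mulnC leq_mul2r -ltnS dk orbT.
  pose i0 := enum_rank_in hmem (0, Ordinal dk).
  have hi0 : mono i0 = (0, Ordinal dk) by rewrite /mono enum_rankK_in.
  rewrite (bigD1 i0) ?hi0 ?eqxx //= mxE hi0 /= big1 ?addr0 // => i /andP[/andP[/eqP h1 /eqP h2]].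
  case/eqP; apply: enum_val_inj; rewrite -/(mono i) -/(mono i0) hi0.
  by case: (mono i) h1 h2 => a b /= -> h2; congr (_, _); apply: val_inj.
have hxP P : (x *m gen_mx) 0 P = p.[tP P].
  rewrite gen_mxE (bigD1 0) //= hx eqxx chi1 mulr1 big1 ?addr0 // => j j0.
  by rewrite hx (negbTE j0) horner0 mul0r.
have hz : #|[set P | ((x - 0) *m gen_mx)%R 0%R P == 0%R]| = (k * m)%N.
  rewrite -hBk -sum_nat_const -sum1_card (partition_big tP (mem B)) /=; last first.
    move=> P; rewrite inE subr0 hxP /p horner_prod prodf_seq_eq0 => /hasP[b].
    by rewrite mem_enum => bB; rewrite !hornerE subr_eq0 => /eqP ->.
  apply: eq_bigr => b bB; rewrite -(hB bB) -sum1_card; apply: eq_bigl => P.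
  rewrite !inE subr0 hxP; case: (eqVneq (tP P) b) => [->|_]; rewrite ?andbF ?andbT //.
  rewrite /p horner_prod (bigD1_seq b) ?mem_enum ?enum_uniq //= !hornerE subrr mul0r.
  exact: eqxx.
exists (x *m gen_mx), (0 *m gen_mx); split.
- by apply/codeP; exists x.
- by apply/codeP; exists 0.
- rewrite mul0mx; apply: contraTneq hkN => /inj x0; rewrite -leqNgt.
  by rewrite -hz x0 subr0 (_ : [set P | _] = setT) ?cardsT ?card_ord //; apply/setP => P; rewrite !inE mul0mx mxE eqxx.
by rewrite hd hz.
Qed.

End EvaluationCode.

(* [weight j] is the pole order of y^(j %/ r) z^(j %% r), where y, z and t have pole orders
   2r, q^2 - q and m at infinity. *)
Section Weights.

Local Open Scope nat_scope.

Variables (q r m' : nat).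
Let m := m'.+1.
Hypothesis hm : m = (r * q.+1).
Hypothesis q1 : (1 < q).
Hypothesis q2 : ~~ odd q.
Hypothesis hqr : coprime r (q ^ 2 - q).

Definition weight (j : nat) : nat := (2 * r * (j %/ r) + (q ^ 2 - q) * (j %% r)).

Lemma r_gt0 : (0 < r).
Proof. by move: hm; case: r. Qed.
Let r0 := r_gt0.

Lemma eqmod_cancel (a d x y : nat) : coprime d a -> (x < d) -> (y < d) ->
  (a * x = a * y %[mod d]) -> x = y.
Proof.
move=> cda; wlog le : x y / (y <= x).
  by move=> h xd yd; case: (leqP y x) => [/h|/ltnW/h h' /esym /h' ->] //; apply.
move=> xd yd /eqP; rewrite eqn_mod_dvd ?leq_mul2l ?le ?orbT // -mulnBr Gauss_dvdr //.
rewrite -eqn_mod_dvd // !modn_small // => /eqP //.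
Qed.

(** Modulo r only the z-part remains, and q^2 - q is invertible there; after that, 2 is invertible
    modulo q + 1. *)
Lemma weight_inj (j k : nat) : (j < m) -> (k < m) ->
  (weight j = weight k %[mod m]) -> j = k.
Proof.
move=> jm km h.
have hmod : j %% r = k %% r.
  apply: (eqmod_cancel hqr); rewrite ?ltn_mod //.
  have hr : r %| m by rewrite hm dvdn_mulr.
  have := congr1 (modn^~ r) h; rewrite /= !modn_dvdm //.
  by rewrite /weight ![(2 * r * _)]mulnAC !modnMDl.
have hdiv : j %/ r = k %/ r.
  have hq2 : coprime q.+1 2 by rewrite coprimen2 /= q2.
  have hlt i : (i < m) -> (i %/ r < q.+1) by rewrite ltn_divLR // mulnC -hm.
  apply: (eqmod_cancel hq2); rewrite ?hlt //.
  move/eqP: h; rewrite /weight hmod eqn_modDr hm -!mulnA ![(2 * (r * _))]mulnCA.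
  by rewrite -!muln_modr eqn_pmul2l // => /eqP.
by rewrite (divn_eq j r) (divn_eq k r) hmod hdiv.
Qed.

(** In a product of two basis monomials, [carry] records that z^r must be reduced, and [wrap] that
    y^(q+1) must be. *)
Definition carry (j k : nat) : bool := (r <= j %% r + k %% r).
Definition wrap (j k : nat) : bool := (m <= j + k).

Lemma add_modE (j k : nat) : (j < m) -> (k < m) ->
  (j + k = (j + k) %% m + wrap j k * m).
Proof.
move=> jm km; rewrite /wrap; case: (leqP m (j + k)) => h.
  rewrite mul1n -[X in (X %% _)](subnK h) modnDr modn_small ?subnK // ltn_subLR //.
  by rewrite -addSn leq_add ?(ltnW km).
by rewrite modn_small // mul0n addn0.
Qed.

Lemma add_mod_r (j k : nat) : (j < m) -> (k < m) ->
  ((j + k) %% m) %% r + carry j k * r = j %% r + k %% r.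
Proof.
move=> jm km; have hr : r %| m by rewrite hm dvdn_mulr.
rewrite modn_dvdm // modnD // /carry; case: leqP => h /=; first by rewrite mul1n subnK.
by rewrite mul0n subn0 addn0.
Qed.

Lemma add_div_r (j k : nat) : (j < m) -> (k < m) ->
  ((j + k) %% m) %/ r + wrap j k * q.+1 = j %/ r + k %/ r + carry j k.
Proof.
move=> jm km; rewrite -divnD // [in RHS](add_modE jm km).
have -> : wrap j k * m = wrap j k * q.+1 * r by rewrite hm -mulnA [q.+1 * r]mulnC.
by rewrite [in RHS]addnC divnMDl // addnC.
Qed.

(** Pole orders add: reducing z^r brings out a polynomial in t of degree q - 2, and reducing y^(q+1)
    one of degree 2. *)
Lemma weight_add (j k : nat) : (j < m) -> (k < m) ->
  m * (carry j k * (q - 2) + wrap j k * 2) + weight ((j + k) %% m) = weight j + weight k.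
Proof.
move=> jm km; have h1 := add_mod_r jm km; have h2 := add_div_r jm km.
rewrite /weight; move: h1 h2.
move: (_ %% r) (_ %/ r) => s1 s2.
move: (j %% r) (k %% r) (j %/ r) (k %/ r) (nat_of_bool _) (nat_of_bool _).
move=> l l' i i' ec ew h1 h2; rewrite hm; move: q1 h1 h2; clear.
case: q => [|[|p]] // _ h1 h2.
have -> : p.+2 ^ 2 - p.+2 = p.+2 * p.+1 by rewrite -mulnn -{3}[p.+2]muln1 -mulnBr subn1.
rewrite !subSS subn0.
have := congr1 (muln (p.+2 * p.+1)) h1; have := congr1 (muln (2 * r)) h2.
by clear; lia.
Qed.

Lemma sum_weight (p : nat) :
  (\sum_(j < r * p) weight j) * 2 + (q ^ 2 - q) * r * p + 2 * r * r * p =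
  2 * r * r * p * p + (q ^ 2 - q) * r * r * p.
Proof.
have htri k : (\sum_(l < k) l) * 2 + k = k * k.
  elim: k => [|k]; rewrite ?big_ord0 // big_ord_recr /= mulnDl.
  by move: (\sum_(l < k) _) => T; lia.
elim: p => [|p IH]; first by rewrite !muln0 big_ord0.
have -> : \sum_(j < r * p.+1) weight j =
    \sum_(j < r * p) weight j + (2 * r * p * r + (q ^ 2 - q) * \sum_(l < r) l).
  rewrite mulnSr big_split_ord /=; congr (_ + _).
  transitivity (\sum_(l < r) (2 * r * p + (q ^ 2 - q) * l)).
    apply: eq_bigr => l _; rewrite /weight [r * p]mulnC divnMDl // modnMDl.
    by rewrite divn_small // modn_small // addn0.
  by rewrite big_split /= sum_nat_const card_ord -big_distrr /= [r * _]mulnC.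
have := htri r; move: IH; move: (\sum_(l < r) l) (\sum_(j < r * p) _) (q ^ 2 - q) => T S a.
move=> h1 h2; have := congr1 (muln a) h2; move: h1; clear; lia.
Qed.

Lemma weight_le (j : nat) : j < m -> weight j + (q ^ 2 - q) <= m * q.
Proof.
move=> jm; rewrite /weight.
have h1 : j %/ r <= q by rewrite -ltnS ltn_divLR // mulnC -hm.
have h2 : j %% r < r by rewrite ltn_mod.
have -> : m * q = 2 * r * q + (q ^ 2 - q) * r.
  rewrite hm; move: q1; clear; case: q => [|p] // _.
  have -> : p.+1 ^ 2 - p.+1 = p.+1 * p by rewrite -mulnn -{3}[p.+1]muln1 -mulnBr subn1.
  by lia.
by rewrite -addnA -mulnSr leq_add ?leq_mul.
Qed.

(* The least nonnegative integer making [weight j + pad j] a multiple of m. *)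
Definition pad (j : 'I_m'.+1) : 'I_m'.+1 := (- inZp (weight j))%R.

Lemma dvdn_pad (j : 'I_m'.+1) : m %| weight j + pad j.
Proof.
rewrite /dvdn -modnDml /pad /= modnDmr -/m.
by rewrite subnKC ?modnn //; apply/ltnW/ltn_pmod.
Qed.

Lemma pad_inj : injective pad.
Proof.
move=> i j /oppr_inj /(congr1 val) /= h; apply: val_inj.
by apply: weight_inj h; apply: ltn_ord.
Qed.

(** Index j admits k + 1 - [u j] exponents of t, where [u j] is [weight j] / m rounded up. The
    weights represent every residue modulo m once, so the paddings sum to 0 + 1 + ... + (m - 1). *)
Lemma card_low_monomials (k : nat) : q.-1 <= k ->
  #|low_monomials (fun j : 'I_m'.+1 => weight j) k| * 2 + (q - 1) * m =
  2 * k * m + 1 + (q ^ 2 - q).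
Proof.
move=> qk; pose u (j : 'I_m'.+1) := (weight j + pad j) %/ m.
have hu j : u j * m = weight j + pad j by rewrite divnK // dvdn_pad.
have hp j : pad j < m by apply: ltn_ord.
(* By [weight_le], [u j] is at most q; with q - 1 <= k the truncated subtractions below are
   exact. *)
have uq j : u j <= k.+1.
  apply: (@leq_trans q); last by move: qk q1; lia.
  rewrite -ltnS -(@ltn_pmul2r m) // hu mulSn.
  have := weight_le (ltn_ord j); rewrite mulnC; have := hp j; move: (q ^ 2 - q); lia.
have hc : #|low_monomials (fun j : 'I_m'.+1 => weight j) k| = \sum_(j < m) (k.+1 - u j).
  rewrite -sum1_card (partition_big (fun p : 'I_m'.+1 * 'I_k.+1 => p.1) predT) //=.
  apply: eq_bigr => j _.
  transitivity #|[set x : 'I_k.+1 | x < k.+1 - u j]|; last first.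
    rewrite -sum1_card (eq_bigl (fun x : 'I_k.+1 => x < k.+1 - u j)) => [|x]; last by rewrite inE.
    by rewrite -(big_ord_widen k.+1 (fun=> 1)) ?leq_subr // sum1_card card_ord.
  rewrite -(card_imset _ (f := fun x : 'I_k.+1 => (j, x))); last by move=> x y [].
  rewrite -sum1_card; apply: eq_bigl => -[i x]; rewrite !inE /=.
  apply/andP/imsetP => [[h /eqP ij]|[y hy [-> ->]]].
    exists x; last by rewrite ij.
    rewrite inE ltn_subRL ltnS -ltnS -(@ltn_pmul2r m) // mulnDl hu mulSn -ij.
    by rewrite mulnC in h; have := hp i; rewrite [x * m]mulnC; lia.
  split=> //; move: hy; rewrite inE ltn_subRL ltnS -(@leq_pmul2r m) // mulnDl hu.
  by rewrite [y * m]mulnC; lia.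
have hsum : \sum_(j < m) (k.+1 - u j) + \sum_(j < m) u j = m * k.+1.
  rewrite -big_split /= -[in RHS](card_ord m) -sum_nat_const; apply: eq_bigr => j _.
  by rewrite subnK.
have hsu : (\sum_(j < m) u j) * m = \sum_(j < m) weight j + \sum_(j < m) j.
  rewrite big_distrl /= [X in _ = _ + X](reindex_inj pad_inj) -big_split /=.
  by apply: eq_bigr => j _; apply: hu.
have htri : (\sum_(j < m) j) * 2 + m = m * m.
  have h p : (\sum_(l < p) l) * 2 + p = p * p.
    elim: p => [|p]; rewrite ?big_ord0 // big_ord_recr /= mulnDl.
    by move: (\sum_(l < p) _) => T; lia.
  exact: h.
have hw := sum_weight q.+1; rewrite -hm in hw.
rewrite hc; move: hsum hsu htri hw.
move: (\sum_(j < m) (k.+1 - u j)) (\sum_(j < m) u j) (\sum_(j < m) weight j) (\sum_(j < m) j).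
move=> C U S T h1 h2 h3 h4.
have {h1}h1 := congr1 (muln m) h1; apply/eqP; rewrite -(@eqn_pmul2l m) //; apply/eqP.
move: h1 h2 h3 h4; rewrite hm; move: q1; clear.
case: q => [|p] // _; rewrite subn1 /=.
have -> : p.+1 ^ 2 - p.+1 = p.+1 * p by rewrite -mulnn -{3}[p.+1]muln1 -mulnBr subn1.
by clear; lia.
Qed.

End Weights.

(** * The curve y^(q+1) = t^2 + t, z^r = y (t^(q-1) + 1) / (t + 1) *)

Section Curve.

Variables (F : finFieldType) (e j h m' r : nat).
Let q := (2 ^ e)%N.
Let n := j.+1.*2.+1.
Let m := m'.+1.
Hypothesis e0 : (0 < e)%N.
Hypothesis hF : #|F| = (q ^ (2 * n))%N.
Hypothesis hmh : (m * h = q ^ n + 1)%N.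
Hypothesis hm : m = (r * q.+1)%N.

Let ch2 : 2 \in [pchar F] := pchar2_card hF.
Let q1 : (1 < q)%N := q_gt1 e0.
Let r0 : (0 < r)%N := r_gt0 hm.
Let ratio := ratio_poly F q.

Lemma q_even : ~~ odd q.
Proof. by rewrite oddX orbF -lt0n. Qed.

(** r divides q^n + 1, which is prime to q and is 2 modulo the odd number q - 1. *)
Lemma coprime_r : coprime r (q ^ 2 - q).
Proof.
have hr : (r %| q ^ n + 1)%N by rewrite -hmh hm mulnAC -mulnA dvdn_mulr.
apply: coprime_dvdl hr _.
have -> : (q ^ 2 - q = q * (q - 1))%N by rewrite mulnBr muln1 mulnn.
rewrite addn1 coprimeMr ![coprime (q ^ n).+1 _]coprime_sym; apply/andP; split.
  by rewrite -(@coprime_pexpl n) // coprimenS.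
have /dvdnP[k hk] : (q - 1 %| q ^ n - 1)%N by rewrite !subn1 dvdn_pred_predX.
have -> : (q ^ n).+1 = (k * (q - 1) + 2)%N.
  by rewrite -hk addn2 subn1 prednK // expn_gt0 ltnW.
rewrite /coprime gcdnMDl -/(coprime _ _) coprimen2 oddB ?(ltnW q1) //.
by rewrite (negbTE q_even).
Qed.

Lemma X2X_monic : 'X^2 + 'X \is @monic F.
Proof. by rewrite monicE lead_coefDl ?lead_coefXn // size_polyX size_polyXn. Qed.

Lemma ratio_monic : ratio \is monic.
Proof.
rewrite -(monicMl _ X2X_monic) ratio_polyE ?(ltnW q1) //.
by rewrite monicE lead_coefDl ?lead_coefXn // size_polyX size_polyXn ltnS.
Qed.

Definition structure_poly (i k : 'I_m'.+1) : {poly F} :=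
  ratio ^+ carry r i k * ('X^2 + 'X) ^+ wrap m' i k.

Lemma structure_poly_monic i k : structure_poly i k \is monic.
Proof. by rewrite monicMl monic_exp ?X2X_monic ?ratio_monic. Qed.

Lemma structure_poly_weight i k :
  (m * (size (structure_poly i k)).-1 + weight q r (i + k)%R = weight q r i + weight q r k)%N.
Proof.
rewrite -(weight_add hm q1 (ltn_ord i) (ltn_ord k)); congr (_ * _ + _)%N.
rewrite size_monicM ?monic_exp ?monic_neq0 ?monic_exp ?X2X_monic ?ratio_monic //.
have h1 := size_exp ratio (carry r i k); have h2 := size_exp ('X^2 + 'X : {poly F}) (wrap m' i k).
rewrite size_ratio_poly // in h1; rewrite size_X2X // in h2.
have : (0 < size (ratio ^+ carry r i k)%R)%N by rewrite size_poly_gt0 monic_neq0 ?monic_exp ?ratio_monic.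
have : (0 < size (('X^2 + 'X : {poly F}) ^+ wrap m' i k)%R)%N by rewrite size_poly_gt0 monic_neq0 ?monic_exp ?X2X_monic.
move: h1 h2; case: (size _) => // s1; case: (size _) => // s2 /= -> -> _ _.
by rewrite addnS /= subn2 mulnC [(2 * _)%N]mulnC.
Qed.

Variable B : {set F}.
Hypothesis hB : B \subset split_points F e j h.

(** The points above F_q are kept as well: they supply the term q^2 - q of the length. *)
Definition curve_points : {set F * F * F} :=
  [set p | [&& p.1.2 ^+ q.+1 == p.1.1 ^+ 2 + p.1.1, p.2 ^+ r == p.1.2 * ratio.[p.1.1]
    & (p.1.1 \in B) || (p.1.1 ^+ q == p.1.1)]].

Definition fiber (t : F) : {set F * F * F} := [set p in curve_points | p.1.1 == t].

(** z runs over the m-th roots of f(t) and determines y, since the ratio is nonzero at t. *)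
Lemma card_fiber_B (t : F) : t \in B -> #|fiber t| = m.
Proof.
move=> tB; have := subsetP hB t tB; rewrite inE => /andP[tq /eqP hf].
have rt0 : ratio.[t] != 0.
  have := fq_sum_neq0 hF tq; rewrite -(ratio_poly_horner ch2 (ltnW q1)) mulf_eq0.
  by case/norP.
have hd : (m * (h * (q ^ n - 1)) = #|F|.-1)%N by rewrite mulnA hmh -(card_units hF).
rewrite -(card_pow_fiber hd hf).
rewrite -(card_imset _ (f := fun z : F => (t, z ^+ r / ratio.[t], z))); last by move=> x y [].
apply: eq_card => -[[t' y] z]; rewrite !inE /=.
apply/andP/imsetP => [[/and3P[/eqP hy /eqP hz _] /eqP ht]|[z' hz [-> -> ->]]].
  rewrite {}ht in hy hz *; exists z; last by rewrite hz mulfK.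
  by rewrite inE hm exprM hz exprMn hy fiber_poly_horner.
split=> //; rewrite tB /= divfK // eqxx andbT.
move: hz; rewrite inE hm exprM fiber_poly_horner => /eqP hz.
by rewrite expr_div_n hz mulfK ?eqxx // expf_neq0.
Qed.

Lemma card_fiber_01 (t : F) : t ^+ 2 + t = 0 -> #|fiber t| = 1%N.
Proof.
move=> ht; rewrite -(cards1 (t, 0 : F, 0 : F)); apply: eq_card => -[[t' y] z].
rewrite !inE /= !xpair_eqE; case: (eqVneq t' t) => [->|_]; rewrite ?andbF ?andbT //=.
have -> : (t ^+ q == t).
  have := ratio_poly_horner ch2 (ltnW q1) t; rewrite ht mul0r => /esym/eqP.
  by rewrite addr_eq0 oppr_pchar2.
rewrite orbT andbT ht expf_eq0 /=; case: eqVneq => [->|] //=.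
by rewrite mul0r expf_eq0 r0.
Qed.

(** The ratio vanishes, so z = 0. Being a nonzero element of F_q, t^2 + t is a (q+1)-th power and
    has q + 1 roots y. *)
Lemma card_fiber_q (t : F) : t ^+ q = t -> t ^+ 2 + t != 0 -> #|fiber t| = q.+1.
Proof.
move=> htq ht.
have hr : ratio.[t] = 0.
  apply/eqP; have := ratio_poly_horner ch2 (ltnW q1) t.
  by rewrite htq addrr_pchar2 // => /eqP; rewrite mulf_eq0 (negbTE ht).
have hd : (q.+1 * ((q ^ n - 1) * ((q ^ n + 1) %/ q.+1)) = #|F|.-1)%N.
  by rewrite mulnCA (cofactor_mul j e0) mulnC (card_units hF).
have hsol : (t ^+ 2 + t) ^+ ((q ^ n - 1) * ((q ^ n + 1) %/ q.+1)) = 1.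
  have /dvdnP[k hk] : (q.-1 %| q ^ n - 1)%N by rewrite subn1 dvdn_pred_predX.
  have h1 : (t ^+ 2 + t) ^+ q.-1 = 1.
    apply: (mulfI ht); rewrite -exprS prednK ?(ltnW q1) // mulr1.
    by rewrite exprD_2pow // exprAC htq.
  by rewrite hk mulnC mulnA mulnC exprM h1 expr1n.
rewrite -[RHS](card_pow_fiber hd hsol).
rewrite -(card_imset _ (f := fun y : F => (t, y, 0 : F))); last by move=> x y [].
apply: eq_card => -[[t' y] z]; rewrite !inE /=.
apply/andP/imsetP => [[/and3P[/eqP hy /eqP hz _] /eqP tt]|[y' hy [-> -> ->]]].
  rewrite {}tt in hy hz *; move/eqP: hz; rewrite hr mulr0 expf_eq0 r0 /= => /eqP ->.
  by exists y; rewrite // inE hy.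
split=> //; rewrite htq eqxx orbT andbT hr mulr0 expr0n gtn_eqF // eqxx andbT.
by move: hy; rewrite inE.
Qed.

Lemma card_curve_points : #|curve_points| = (m * #|B| + (q ^ 2 - q))%N.
Proof.
pose Z01 : {set F} := [set 0; 1].
pose K := [set x : F | x ^+ q == x] :\ 0 :\ 1.
have hK : (#|K| + 2 = q)%N.
  have hq := card_Fq e0 hF.
  rewrite (cardsD1 0) (cardsD1 1) !inE expr0n expr1n (gtn_eqF (ltnW q1)) eqxx oner_eq0 /= in hq.
  by rewrite -[RHS]hq eqxx addnC.
have h01 (t : F) : (t \in Z01) = (t ^+ 2 + t == 0).
  have -> : t ^+ 2 + t = t * (t + 1) by ring.
  by rewrite mulf_eq0 addr_eq0 oppr_pchar2 // !inE.
have hsum (A : {set F}) : (\sum_t (t \in A) = #|A|)%N.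
  by rewrite -sum1_card [RHS]big_mkcond; apply: eq_bigr => t _; case: ifP.
have hBq t : t \in B -> t ^+ q != t.
  by move/(subsetP hB); rewrite inE => /andP[].
have hfib (t : F) : #|fiber t| = (m * (t \in B) + (q.+1 * (t \in K) + (t \in Z01)))%N.
  have hK01 : (t \in K) = (t ^+ q == t) && (t \notin Z01).
    by rewrite !inE negb_or; case: (t == 0); case: (t == 1); rewrite ?andbF ?andbT.
  rewrite hK01 h01; case: (eqVneq (t ^+ 2 + t) 0) => [h0|h0] /=.
    have htq : t ^+ q = t.
      have := ratio_poly_horner ch2 (ltnW q1) t; rewrite h0 mul0r => /esym/eqP.
      by rewrite addr_eq0 oppr_pchar2 // => /eqP.
    rewrite card_fiber_01 // andbF muln0 (_ : (t \in B) = false) ?muln0 //.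
    by apply/negP => /hBq; rewrite htq eqxx.
  case: (eqVneq (t ^+ q) t) => htq /=.
    rewrite card_fiber_q // muln1 addn0 (_ : (t \in B) = false) ?muln0 //.
    by apply/negP => /hBq; rewrite htq eqxx.
  case: (boolP (t \in B)) => tB; first by rewrite card_fiber_B // muln1 muln0 !addn0.
  rewrite !muln0; apply/eqP; rewrite cards_eq0; apply/eqP/setP => p; rewrite !inE.
  by case: (eqVneq p.1.1 t) => [->|_]; rewrite ?andbF // (negbTE tB) (negbTE htq) !andbF.
rewrite -sum1_card (partition_big (fun p : F * F * F => p.1.1) predT) //=.
rewrite (eq_bigr (fun t => m * (t \in B) + (q.+1 * (t \in K) + (t \in Z01)))%N); last first.
  move=> t _; rewrite -hfib -sum1_card; apply: eq_bigl => p; by rewrite [in RHS]inE.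
rewrite !big_split /= -!big_distrr /= !hsum cards2 eq_sym oner_eq0 /=; congr (_ + _)%N.
(* The q - 2 elements of [K] and the two of [Z01] give (q + 1) (q - 2) + 2 = q^2 - q. *)
have hcount a b : (a.+2 = b -> b.+1 * a + 2 = b ^ 2 - b)%N.
  move=> <-; rewrite -mulnn (_ : a.+2 * a.+2 - a.+2 = a.+2 * a.+1)%N; first by lia.
  by rewrite [(_ * a.+2)%N]mulnS addKn.
by move: hK; rewrite addn2; exact: hcount.
Qed.

Let point (P : 'I_#|curve_points|) : F * F * F := enum_val P.
Let pt_t P := (point P).1.1.
Let pt_y P := (point P).1.2.
Let pt_z P := (point P).2.

Let pt_yE P : pt_y P ^+ q.+1 = pt_t P ^+ 2 + pt_t P.
Proof. by have := enum_valP P; rewrite inE => /and3P[/eqP]. Qed.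

Let pt_zE P : pt_z P ^+ r = pt_y P * ratio.[pt_t P].
Proof. by have := enum_valP P; rewrite inE => /and3P[_ /eqP]. Qed.

Let chi P (i : 'I_m'.+1) : F := pt_y P ^+ (i %/ r)%N * pt_z P ^+ (i %% r)%N.

Lemma chiM P i k : chi P i * chi P k = (structure_poly i k).[pt_t P] * chi P (i + k).
Proof.
rewrite /chi /structure_poly hornerM !horner_exp.
rewrite -[val (i + k)]/((i + k) %% m)%N.
have h1 := add_mod_r hm (ltn_ord i) (ltn_ord k).
have h2 := add_div_r hm (ltn_ord i) (ltn_ord k).
have hz : pt_z P ^+ (i %% r)%N * pt_z P ^+ (k %% r)%N =
    pt_z P ^+ ((i + k) %% m %% r)%N * (pt_y P ^+ carry r i k * ratio.[pt_t P] ^+ carry r i k).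
  by rewrite -exprD -h1 exprD [(carry _ _ _ * r)%N]mulnC exprM pt_zE exprMn.
have hy : pt_y P ^+ (i %/ r)%N * pt_y P ^+ (k %/ r)%N * pt_y P ^+ carry r i k =
    pt_y P ^+ ((i + k) %% m %/ r)%N * ('X^2 + 'X : {poly F}).[pt_t P] ^+ wrap m' i k.
  rewrite -!exprD -h2 exprD [(wrap _ _ _ * _)%N]mulnC exprM pt_yE.
  by rewrite hornerD hornerXn hornerX.
transitivity (pt_z P ^+ ((i + k) %% m %% r)%N * ratio.[pt_t P] ^+ carry r i k *
    (pt_y P ^+ (i %/ r)%N * pt_y P ^+ (k %/ r)%N * pt_y P ^+ carry r i k)).
  by rewrite mulrACA hz; ring.
by rewrite hy; ring.
Qed.

Lemma chi0 P : chi P 0 = 1.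
Proof. by rewrite /chi /= div0n mod0n !expr0 mulr1. Qed.

(** Index r recovers y. Index 1 recovers z if r > 1, and for r = 1 the equation of the curve gives z
    from y and t. *)
Lemma chi_injective P P' : pt_t P = pt_t P' -> chi P =1 chi P' -> P = P'.
Proof.
move=> ht hchi.
have hy : pt_y P = pt_y P'.
  have hrm : (r < m'.+1)%N by rewrite [m'.+1]hm -{1}[r]muln1 ltn_pmul2l // ltnS ltnW.
  by have := hchi (Ordinal hrm); rewrite /chi /= divnn modnn r0 !expr1 !expr0 !mulr1.
have hz : pt_z P = pt_z P'.
  have [r1|r1] : r = 1%N \/ (1 < r)%N by lia.
    by have := pt_zE P; have := pt_zE P'; rewrite r1 !expr1 -ht -hy => -> ->.
  have hrm : (1 < m'.+1)%N by rewrite [m'.+1]hm; nia.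
  by have := hchi (Ordinal hrm); rewrite /chi /= divn_small // modn_small // !expr0 !expr1 !mul1r.
apply: enum_val_inj; move: ht hy hz; rewrite /pt_t /pt_y /pt_z /point.
by case: (enum_val P) (enum_val P') => [[a b] c] [[a' b'] c'] /= -> -> ->.
Qed.

Lemma curve_code (k : nat) : (k <= #|B|)%N -> exists C : {vspace 'rV[F]_#|curve_points|},
  is_linear_code #|low_monomials (fun i : 'I_m'.+1 => weight q r i) k|
    (#|curve_points| - k * m) C.
Proof.
move=> kB.
have [A AB Ak] := subset_of_card kB.
eexists; apply: (@evaluation_code F m' _ structure_poly _ _ _ _ _ pt_t chi _ _ _ k A) => //.
- exact: structure_poly_monic.
- exact: structure_poly_weight.
- move=> i i' hw; apply: val_inj.
  exact: (weight_inj hm q_even coprime_r (ltn_ord i) (ltn_ord i') hw).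
- by rewrite /weight div0n mod0n !muln0.
- exact: chiM.
- exact: chi0.
- exact: chi_injective.
(* The points above F_q make k m < N strict even when k is the size of B. *)
- rewrite card_curve_points mulnC; apply: (@leq_ltn_trans (m * #|B|)).
    by rewrite leq_mul2l kB orbT.
  by rewrite -[X in (X < _)%N]addn0 ltn_add2l subn_gt0 -{1}[q]expn1 ltn_exp2l.
move=> b bA; rewrite -[RHS](card_fiber_B (subsetP AB b bA)).
rewrite -(card_imset _ enum_val_inj); apply: eq_card => p; rewrite !inE.
apply/imsetP/andP => [[P hP ->]|[hp hb]].
  by rewrite inE in hP; have := enum_valP P; rewrite inE.
have hp' : p \in curve_points by rewrite inE.
exists (enum_rank_in hp' p); last by rewrite enum_rankK_in.
by rewrite inE /pt_t /point enum_rankK_in.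
Qed.

End Curve.

Theorem proposition5p5 (q n m : nat) (F : finFieldType) (k : int)
  (hq : exists e : nat, q = (2 ^ e)%N) (hq4 : (4 <= q)%N)
  (hn3 : (3 <= n)%N) (hn : odd n)
  (hm2 : (2 <= m)%N) (hmq : (m %| q ^ n + 1)%N) (hqm : (q + 1 %| m)%N)
  (hF : #|F| = (q ^ (2 * n))%N)
  (hk1 : q%:Q - 1 <= k%:Q)
  (hk2 : k%:Q <= (q%:Q ^+ n - q%:Q ^+ 2 + q%:Q) * (q%:Q ^+ n + 1) / m%:Q
                 + q%:Q ^+ (n + 1) - q%:Q ^+ n) :
  exists N K d : nat,
    [/\ N%:Q = q%:Q ^+ (2 * n) - q%:Q ^+ (n + 2)
               + (m%:Q + 1) * q%:Q ^+ (n + 1) - (m%:Q - 1) * q%:Q ^+ n,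
        K%:Q = k%:Q * m%:Q + 1
               - ((q%:Q - 1) * m%:Q - q%:Q ^+ 2 + q%:Q + 1) / 2%:Q,
        d%:Q = N%:Q - k%:Q * m%:Q
      & exists C : {vspace 'rV[F]_N}, is_linear_code K d C].
Proof.
case: hq => e he; subst q.
have e0 : (0 < e)%N by case: e hq4 {hmq hqm hF hk1 hk2}.
have [j hj] : exists j, n = j.+1.*2.+1.
  exists (n./2).-1; have := odd_double_half n; rewrite hn; move: hn3; clear; lia.
have [h hmh'] := dvdnP hmq; have {}hmh : (m * h = (2 ^ e) ^ n + 1)%N by rewrite hmh' mulnC.
have [r hmr] := dvdnP hqm.
have [m' hm'] : exists m', m = m'.+1 by exists m.-1; rewrite prednK // ltnW.
have hm : (m'.+1 = r * (2 ^ e).+1)%N by rewrite -hm' hmr addn1.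
have hq1 : (1 <= 2 ^ e)%N by rewrite expn_gt0.
have natQ (a : nat) : a%:Q = a%:R by rewrite -pmulrn.
have [k0 hk0] : exists k0 : nat, k = k0.
  exists `|k|%N; rewrite gez0_abs // -(ler0z rat) (le_trans _ hk1) //.
  by rewrite natQ subr_ge0 ler1n.
rewrite {}hk0 !natQ in hk1 hk2 *.
pose q := (2 ^ e)%N; pose Q := (q ^ n)%N; rewrite -/q in hq4 hmq hqm hF hk1 hk2 hq1 hm hmr hmh hmh' *.
have hqk : (q.-1 <= k0)%N.
  by rewrite -subn1 -(ler_nat rat) natrB.
(* The upper bound on k, with (q^n + 1) / m = h, is also the lower bound on the number of split
   points. *)
pose s := ((Q - (q ^ 2 - q)) * h + q * Q - Q)%N.
have hqq : (q <= q ^ 2)%N by rewrite -{1}[q]expn1 leq_pexp2l.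
have hqQ : (q ^ 2 - q <= Q)%N.
  by apply: leq_trans (leq_subr _ _) _; rewrite leq_pexp2l // ltnW.
have hQq : (Q <= q * Q)%N by rewrite leq_pmull.
have hQq' : (Q <= (Q - (q ^ 2 - q)) * h + q * Q)%N by rewrite (leq_trans hQq) // leq_addl.
have hsQ : s%:R = (Q%:R - (q%:R ^+ 2 - q%:R)) * h%:R + q%:R * Q%:R - Q%:R :> rat.
  by rewrite /s natrB // natrD !natrM natrB // natrB // natrX.
have hmhQ : m%:R * h%:R = Q%:R + 1 :> rat by rewrite -natrM hmh natrD.
have m0 : m%:R != 0 :> rat by rewrite pnatr_eq0 hm'.
have hQX : Q%:R = q%:R ^+ n :> rat by rewrite natrX.
have hks : (k0 <= s)%N.
  rewrite -(ler_nat rat) (le_trans hk2) // hsQ exprD expr1 -hQX -hmhQ.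
  by rewrite le_eqVlt; apply/orP; left; apply/eqP; field.
have hsplit : (s <= #|split_points F e j h|)%N.
  rewrite /s /Q /q hj; apply: (@card_split_points F e j m h e0).
  - by rewrite -hj.
  - by rewrite -hj.
  - by rewrite -addn1.
(* Exactly s split values are kept whatever k is, so that the length is the prescribed N. *)
have [B hB hBs] := subset_of_card hsplit.
have [C hC] : exists C : {vspace 'rV[F]_#|curve_points e r B|},
  is_linear_code #|low_monomials (fun i : 'I_m'.+1 => weight q r i) k0|
    (#|curve_points e r B| - k0 * m'.+1) C.
  apply: (@curve_code F e j h m' r) => //; rewrite ?hBs // -?hj //.
  by rewrite -hm'.
have hN : #|curve_points e r B| = (m * s + (q ^ 2 - q))%N.
  rewrite (@card_curve_points F e j h m' r) // ?hBs -?hm' // -?hj //.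
have hK : (#|low_monomials (fun i : 'I_m'.+1 => weight q r i) k0| * 2 + (q - 1) * m = 2 * k0 * m + 1 + (q ^ 2 - q))%N.
  rewrite hm'; apply: card_low_monomials => //.
  - exact: q_gt1 e0.
  - exact: q_even e0.
  - by apply: (coprime_r (j := j) (h := h) e0 _ hm); rewrite -hj -hm'.
exists #|curve_points e r B|, #|low_monomials (fun i : 'I_m'.+1 => weight q r i) k0|.
exists (#|curve_points e r B| - k0 * m'.+1)%N; split; last by exists C.
- rewrite natQ hN natrD natrM hsQ natrB // natrX.
  rewrite mulnC exprM !exprD expr1 -hQX.
  transitivity ((Q%:R - (q%:R ^+ 2 - q%:R)) * (m%:R * h%:R) + m%:R * (q%:R * Q%:R - Q%:R) + (q%:R ^+ 2 - q%:R) : rat).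
    by ring.
  by rewrite hmhQ; ring.
- have := congr1 (fun a : nat => a%:R : rat) hK.
  rewrite natQ !natrD !natrM natrB // natrB // natrX => hK'.
  have solve (X a b c : rat) : X * 2 + (a - 1) * b = 2 * c * b + 1 + (a ^+ 2 - a) ->
      X = c * b + 1 - ((a - 1) * b - a ^+ 2 + a + 1) / 2.
    move=> hX; apply: (mulIf (_ : 2 != 0)) => //; rewrite -[LHS](addrK ((a - 1) * b)) hX.
    by field.
  exact: solve.
rewrite !natQ natrB ?natrM -?hm' //.
rewrite hN mulnC; apply: leq_trans (leq_addr _ _); by rewrite leq_mul2l hks orbT.
Qed.
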